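(* Let $Q$ be an $(n,q)$-cactus with $q\ge 2$. Then (a) $n-2q+2\le\overrightarrow{rvc}(Q)\le n-2$; (b) $2n-3q+3\le\overrightarrow{trc}(Q)\le 2n-3$.
   Context: Digraphs are finite, without loops or multiple arcs. A cactus is a strongly connected oriented graph (no pair of opposite arcs) in which every arc belongs to exactly one directed cycle; its blocks are directed cycles. An $(n,q)$-cactus is a cactus with $n$ vertices and $q$ blocks (equivalently, it decomposes into $q$ directed cycles). $\overrightarrow{rvc}(D)$ is the minimum number of colours in a vertex-colouring such that every ordered pair $(x,y)$ of vertices is joined by a directed path whose internal vertices have distinct colours. $\overrightarrow{trc}(D)$ is the minimum number of colours in a total-colouring (of vertices and arcs) such that every ordered pair is joined by a directed path whose arcs and internal vertices all receive pairwise distinct colours. *)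

(* Defs.v *)
From HB Require Import structures.
From mathcomp Require Import all_boot all_order all_algebra.
Set Implicit Arguments.
Unset Strict Implicit.
Unset Printing Implicit Defensive.

(* A digraph on the finite vertex set T is its arc relation e : rel T, so
   multiple arcs are excluded by construction. *)

Definition arcs (T : finType) (e : rel T) : {set T * T} :=
  [set a | e a.1 a.2].

Definition strongly_connected (T : finType) (e : rel T) : Prop :=
  forall x y : T, connect e x y.

Definition cycle_arcs (T : finType) (c : seq T) : {set T * T} :=
  [set a | (a.1 \in c) && (a.2 == next c a.1)].

(* A directed cycle is identified with its set of arcs, so that the cyclic
   vertex sequences differing by a rotation are the same cycle. *)
Definition directed_cycle (T : finType) (e : rel T) (C : {set T * T}) : Prop :=
  exists c : seq T, [/\ c != [::], ucycle e c & C = cycle_arcs c].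

Record cactus (T : finType) (e : rel T) : Prop := Cactus {
  cactus_loopless : irreflexive e;
  cactus_oriented : forall x y : T, e x y -> ~~ e y x;
  cactus_strong : strongly_connected e;
  cactus_arc : forall a : T * T, a \in arcs e ->
    exists! C : {set T * T}, directed_cycle e C /\ a \in C
}.

(* The blocks of a cactus are the directed cycles into which its arc set
   decomposes. *)
Definition nq_cactus (n q : nat) (T : finType) (e : rel T) : Prop :=
  [/\ cactus e, #|T| = n &
      exists P : {set {set T * T}},
        [/\ partition P (arcs e),
            forall C, C \in P -> directed_cycle e C & #|P| = q]].

(* The directed path x :: p ends at y; its vertices are pairwise distinct. *)
Definition dipath (T : finType) (e : rel T) (x y : T) (p : seq T) : bool :=
  [&& path e x p, last x p == y & uniq (x :: p)].

Definition internal (T : Type) (x : T) (p : seq T) : seq T :=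
  behead (belast x p).

Definition path_arcs (T : Type) (x : T) (p : seq T) : seq (T * T) :=
  zip (x :: p) p.

(* The vertices of a path being distinct, p has fewer than #|T| entries: the
   bound on the size is only there to make the quantification finite. *)
Definition joined (T : finType) (e : rel T) (good : T -> seq T -> bool)
    (x y : T) : bool :=
  [exists m : 'I_#|T|, exists p : m.-tuple T, dipath e x y p && good x p].

Definition rainbow_vertex_path (T : finType) (K : eqType) (c : T -> K)
    (x : T) (p : seq T) : bool :=
  uniq [seq c v | v <- internal x p].

Definition total_rainbow_path (T : finType) (K : eqType) (c : T + T * T -> K)
    (x : T) (p : seq T) : bool :=
  uniq ([seq c (inl v) | v <- internal x p]
        ++ [seq c (inr a) | a <- path_arcs x p]).

Definition rvc_colourable (T : finType) (e : rel T) (k : nat) : bool :=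
  [exists c : {ffun T -> 'I_k}, forall x, forall y,
    joined e (rainbow_vertex_path c) x y].

(* c also gives values to the pairs that are not arcs, but these values are
   never used, as path_arcs x p only contains arcs when x :: p is a path. *)
Definition trc_colourable (T : finType) (e : rel T) (k : nat) : bool :=
  [exists c : {ffun T + T * T -> 'I_k}, forall x, forall y,
    joined e (total_rainbow_path c) x y].

Definition least_upto (N : nat) (P : pred nat) : nat :=
  [arg min_(k < @ord_max N | P k) (k : nat)].

(* In a strongly connected digraph, giving all the vertices (resp. all the
   vertices and arcs) distinct colours is always possible within the bound
   below; rvcP and trcP state that the minimum is then attained. *)
Definition rvc (T : finType) (e : rel T) : nat :=
  least_upto #|T| (rvc_colourable e).

Definition trc (T : finType) (e : rel T) : nat :=
  least_upto #|{: T + T * T}| (trc_colourable e).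

Lemma least_uptoP (N : nat) (P : pred nat) : P N ->
  P (least_upto N P) /\ forall k, P k -> least_upto N P <= k.
Proof.
move=> PN; rewrite /least_upto; case: arg_minnP => //= i Pi mini.
split=> // k Pk; have [lekN | ltNk] := leqP k N.
  by have := mini (Ordinal (lekN : k < N.+1)) Pk.
by apply: leq_trans (ltnW ltNk); rewrite -ltnS.
Qed.

Lemma strong_joined (T : finType) (e : rel T) (good : T -> seq T -> bool) x y :
    strongly_connected e -> (forall p, uniq (x :: p) -> good x p) ->
  joined e good x y.
Proof.
move=> /(_ x y)/connectP[p0 e_p0 ->] goodP.
case/shortenP: e_p0 => p e_p Up _.
have ltp : size p < #|T| by have := max_card (mem (x :: p)); rewrite (card_uniqP Up).
apply/existsP; exists (Ordinal ltp); apply/existsP; exists (in_tuple p).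
by rewrite /dipath e_p eqxx /= -/(uniq (x :: p)) Up goodP.
Qed.

Lemma uniq_internal (T : eqType) (x : T) p : uniq (x :: p) -> uniq (internal x p).
Proof.
rewrite lastI rcons_uniq /internal => /andP[_].
by case: (belast x p) => //= z s /andP[].
Qed.

Lemma uniq_path_arcs (T : eqType) (x : T) p :
  uniq (x :: p) -> uniq (path_arcs x p).
Proof.
move=> /andP[_ Up]; apply: (@map_uniq _ _ snd).
by rewrite -/(unzip2 _) unzip2_zip //=.
Qed.

Lemma rvcP (T : finType) (e : rel T) : strongly_connected e ->
  rvc_colourable e (rvc e) /\ forall k, rvc_colourable e k -> rvc e <= k.
Proof.
move=> strong; apply: least_uptoP; apply/existsP; exists [ffun x => enum_rank x].
apply/forallP=> x; apply/forallP=> y; apply: strong_joined => // p Up.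
rewrite /rainbow_vertex_path map_inj_uniq ?uniq_internal // => u v.
by rewrite !ffunE => /enum_rank_inj.
Qed.

Lemma trcP (T : finType) (e : rel T) : strongly_connected e ->
  trc_colourable e (trc e) /\ forall k, trc_colourable e k -> trc e <= k.
Proof.
move=> strong; apply: least_uptoP; apply/existsP; exists [ffun x => enum_rank x].
apply/forallP=> x; apply/forallP=> y; apply: strong_joined => // p Up.
rewrite /total_rainbow_path cat_uniq !map_inj_uniq ?uniq_internal //;
  try by move=> u v; rewrite !ffunE => /enum_rank_inj[].
rewrite uniq_path_arcs // andbT; apply/hasPn=> _ /mapP[a _ ->].
by apply/mapP=> -[v _]; rewrite !ffunE => /enum_rank_inj.
Qed.

(* Main.v *)
Require Import Defs.
From HB Require Import structures.
From mathcomp Require Import all_boot all_order all_algebra.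
From mathcomp Require Import zify.
Set Implicit Arguments.
Unset Strict Implicit.
Unset Printing Implicit Defensive.

(* In a cactus there is exactly one dipath from any vertex to any other, so a
   colouring of a cactus is rainbow as soon as any two items (vertices or arcs)
   met by a common dipath, at its ends excepted, have different colours.

   Lower bounds.  Fix a vertex r lying on two blocks.  Every block has exactly one
   arc entering its gate (the vertex through which it is reached from r) and one
   arc leaving it; the first are the arcs missing from the out-tree of dipaths
   from r, which gives n + q - 1 arcs in all, the second those missing from the
   in-tree.  The remaining arcs, the vertices between two consecutive ones of
   them, and the items r, l, k, (k, r), (r, l), where k -> r -> l passes from one
   block to another, pairwise lie on common dipaths.  These are at least
   n - 2q + 2 vertices and n - q + 1 arcs.

   Upper bounds.  A vertex r, and then a vertex of the leaf block found from r,
   give two leaf blocks, attached at w1 and w2 and leaving their gates by w1 -> u1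
   and w2 -> u2, entering them by v1 -> w1 and v2 -> w2.  No dipath has u1 and u2
   both after its start, nor v1 and v2 both before its end: the vertices u1, u2
   can share a colour, as can v1, v2.  Giving each arc the name of its head, with
   u1 and u2 identified, colours the arcs with n - 1 further colours. *)

(** * Uniqueness of dipaths *)

Section CactusPaths.
Variables (T : finType) (e : rel T).
Hypothesis cacte : cactus e.
Implicit Types (s t u v x y z : T) (p : seq T).

Lemma dipath_exists x y : exists p, dipath e x y p.
Proof.
have /connectP[p0 e_p0 ->] := cactus_strong cacte x y.
by case/shortenP: e_p0 => p e_p Up _; exists p; rewrite /dipath e_p eqxx.
Qed.

Lemma dipath_behead x a y p : dipath e x y (a :: p) -> dipath e a y p.
Proof. by case/and3P=> /= /andP[_ ep] lp /andP[_ Up]; apply/and3P. Qed.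

Lemma cycle_arcs_mem (c : seq T) x : (x \in c) = ((x, next c x) \in cycle_arcs c).
Proof. by rewrite inE /= eqxx andbT. Qed.

(** The arc set determines the successor map [next] on its vertices, and a cyclic sequence is the
    orbit of its first vertex under [next]. Fixing the first vertex [v] removes the freedom of
    rotation. *)
Lemma cycle_arcs_inj v p1 p2 : uniq (v :: p1) -> uniq (v :: p2) ->
  cycle_arcs (v :: p1) = cycle_arcs (v :: p2) -> p1 = p2.
Proof.
move=> U1 U2 eqC; set c1 := v :: p1; set c2 := v :: p2.
have next12 x : x \in c1 -> next c2 x = next c1 x.
  rewrite cycle_arcs_mem eqC inE /= => /andP[_ /eqP].
  by [].
have eqm : c1 =i c2.
  move=> x; apply/idP/idP => [|x2].
    by rewrite cycle_arcs_mem eqC inE => /andP[].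
  by move: x2; rewrite cycle_arcs_mem -eqC inE => /andP[].
have := uniq_size_uniq U1 eqm; rewrite U2 => /esym/eqP sz.
have /fpathP[n1 def1] : fpath (next c1) v p1.
  by have := cycle_next U1; rewrite /= rcons_path => /andP[].
have /fpathP[n2 def2] : fpath (next c2) v p2.
  by have := cycle_next U2; rewrite /= rcons_path => /andP[].
have en : n1 = n2.
  by move: sz; rewrite /c1 /c2 /= def1 def2 !size_traject => -[].
have same x : x \in c1 -> traject (next c1) x n1 = traject (next c2) x n1.
  elim: n1 x {def1 en} => // n IH x x1; rewrite !trajectS next12 // IH //.
  by rewrite mem_next.
by rewrite def1 def2 -en next12 ?mem_head // same // mem_next mem_head.
Qed.

(** Closing such a dipath by the arc u -> v gives a directed cycle through that arc, and there is
    only one. *)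
Lemma return_path_unique u v p1 p2 :
  e u v -> dipath e v u p1 -> dipath e v u p2 -> p1 = p2.
Proof.
move=> euv.
have cyc p : dipath e v u p ->
    directed_cycle e (cycle_arcs (v :: p)) /\ (u, v) \in cycle_arcs (v :: p).
  case/and3P=> e_p /eqP lastp Up; split.
    exists (v :: p); split=> //.
    by rewrite /ucycle /ucycleb Up /= rcons_path e_p lastp euv.
  rewrite inE /= -lastp mem_last eq_sym.
  by have := cycle_next Up; rewrite /= rcons_path => /andP[].
move=> d1 d2; have uva : (u, v) \in arcs e by rewrite inE.
have [C [_ uniqC]] := cactus_arc cacte uva.
have U p : dipath e v u p -> uniq (v :: p) by case/and3P.
by apply: cycle_arcs_inj (U _ d1) (U _ d2) _; rewrite -(uniqC _ (cyc _ d1)) (uniqC _ (cyc _ d2)).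
Qed.

(* A second dipath leaving x by another arc than x1 cannot come back to the
   cycle through the arc x x1, so the rest of that cycle followed by it is a
   dipath from x1 through x. *)
Lemma dipath_unique x y p1 p2 : dipath e x y p1 -> dipath e x y p2 -> p1 = p2.
Proof.
elim: p1 x y p2 => [|x1 p1 IH] x y p2.
  case/and3P=> _ /= /eqP -> _ /and3P[_ /eqP lp Up].
  by case: p2 lp Up => //= a p2 <-; rewrite mem_last.
case: p2 => [|x2 p2].
  case/and3P=> _ /eqP /= <- Up /and3P[_ /= /eqP x_last _].
  by move: Up; rewrite /= {1}x_last mem_last.
move=> d1 d2.
have [ep1' /eqP /= lp1 Up1] := and3P d1; have /= /andP[ex1 ep1] := ep1'.
have [ep2 /eqP lp2 Up2] := and3P d2.
have /= /andP[xnp1 Up1'] := Up1.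
have dp1' : dipath e x1 y p1 by rewrite /dipath ep1 -lp1 eqxx.
have [R dR] := dipath_exists x1 x.
have x1x : x1 != x by apply: contraNneq xnp1 => ->; rewrite inE eqxx.
have [R' defR] : exists R', R = rcons R' x.
  case/and3P: dR => _ /eqP lR _.
  case: R lR => [/= xx1|a R /= lR]; first by rewrite xx1 eqxx in x1x.
  by exists (belast a R); rewrite -lR -lastI.
move: dR; rewrite {R}defR => /and3P[]; rewrite rcons_path => /andP[eR eyx] _ UR.
have {}UR : uniq (rcons (x1 :: R') x) by [].
move: UR; rewrite rcons_uniq => /andP[xR UR].
(* The return path [rcons R' x] from [x1] to [x] closes a cycle through x -> x1. If the second
   dipath meets this cycle again, [z] is the first vertex where it does. *)
have [hit|/hasPn nohit] := boolP (has [in x1 :: R'] (x2 :: p2)).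
  have [z [s1 [s2 [zR s1R defp2]]]] : exists z : T, exists s1 s2 : seq T,
    [/\ z \in x1 :: R', ~~ has [in x1 :: R'] s1 & x2 :: p2 = rcons s1 z ++ s2].
    by case/split_find: hit => z s1 s2 zR s1R; exists z, s1, s2.
  have [r1 [r2 defR]] : exists r1 r2 : seq T, x1 :: R' = r1 ++ z :: r2.
    by case/splitPr: zR => r1 r2; exists r1, r2.
  have da : dipath e x (last x1 R') (x1 :: R').
    by rewrite /dipath /= ex1 eR eqxx xR.
  have db : dipath e x (last x1 R') (rcons s1 z ++ r2).
    move: ep2 Up2; rewrite defp2 cat_path => /andP[es1 _] Us.
    have lz : last x1 R' = last z r2.
      by rewrite -[LHS]/(last x (x1 :: R')) defR last_cat.
    rewrite /dipath cat_path es1 last_cat last_rcons lz eqxx /=.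
    have -> /= : path e z r2.
      have : path e x (x1 :: R') by rewrite /= ex1.
      by rewrite defR cat_path /= => /and3P[].
    have UrR : uniq (r1 ++ z :: r2) by rewrite -defR.
    move: Us xR UrR; rewrite /= defR !mem_cat !mem_rcons !cat_uniq cons_uniq => /andP[].
    rewrite !inE !negb_or -!andbA => /and3P[-> -> _] /and3P[Us1 _ _].
    move=> /and3P[_ _ ->] /and5P[_ _ _ zr2 Ur2].
    rewrite Us1 Ur2 andbT /=; apply/hasPn=> w wr2; rewrite mem_rcons inE negb_or.
    apply/andP; split; first by apply: contraNneq zr2 => <-.
    apply: contra s1R => ws1; apply/hasP; exists w => //.
    by rewrite /= defR mem_cat inE wr2 !orbT.
  (* Both [da] and [db] become cycles by adding the arc from the last vertex of [x1 :: R'] to [x].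
     They therefore coincide, so [x1 = x2], and induction applies to the tails. *)
  have := return_path_unique eyx da db.
  case: s1 {db s1R} defp2 => [|a s1] /= [E2 _] [E _].
    by rewrite E2 -E in d2 *; rewrite (IH _ _ _ dp1' (dipath_behead d2)).
  by rewrite E2 -E in d2 *; rewrite (IH _ _ _ dp1' (dipath_behead d2)).
(* The second dipath stays off the cycle, so the return path followed by it is a dipath from [x1] to
   [y]. By induction it is [p1], which does not contain [x]. *)
have dRp : dipath e x1 y (rcons R' x ++ x2 :: p2).
  rewrite /dipath cat_path rcons_path eR eyx last_cat !last_rcons ep2 lp2 eqxx /=.
  rewrite -cons_uniq -cat_cons -rcons_cons cat_uniq rcons_uniq xR UR.
  have := Up2; rewrite cons_uniq => /andP[xp2 ->]; rewrite andTb andbT.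
  apply/hasPn=> w wp2; rewrite mem_rcons inE negb_or.
  rewrite (nohit w wp2) andbT.
  by apply: contraNneq xp2 => <-.
move: xnp1; rewrite (IH _ _ _ dp1' dRp) inE mem_cat mem_rcons inE eqxx.
by rewrite orbT.
Qed.

End CactusPaths.

(** * Betweenness *)

(* B s x t stands for "x lies on the dipath from s to t". *)
Record betweenness (T : finType) (e : rel T) (B : T -> T -> T -> bool) : Prop :=
  Betweenness {
    bt_oriented : forall x y, e x y -> ~~ e y x;
    bt_source : forall s t, B s s t;
    bt_target : forall s t, B s t t;
    bt_loop : forall s x, B s x s -> x = s;
    bt_triangle : forall s x t z, B s x t -> B s x z \/ B z x t;
    bt_prefix : forall s x y t, B s x t -> B s y x -> B s y t /\ B y x t;
    bt_suffix : forall s x y t, B s x t -> B x y t -> B s y t /\ B s x y;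
    bt_total : forall s x y t, B s x t -> B s y t -> B s x y \/ B s y x;
    bt_arc : forall a b x, e a b -> B a x b -> x = a \/ x = b;
    bt_first : forall a b t, e a b -> B a b t \/ B b a t;
    bt_last : forall a b s, e a b -> B s a b \/ B s b a;
    bt_succ : forall s t, s != t -> exists2 y, e s y & B s y t;
    bt_pred : forall s t, s != t -> exists2 y, e y t & B s y t
  }.

Section Betweenness.
Variables (T : finType) (e : rel T) (B : T -> T -> T -> bool).
Hypothesis bB : betweenness e B.
Implicit Types a b c d k l p r s t u v w x y z : T.

Lemma bt_irrefl x : ~ e x x.
Proof. by move=> exx; have := bt_oriented bB exx; rewrite exx. Qed.

Lemma bt_asym x y : e x y -> e y x -> False.
Proof. by move=> /(bt_oriented bB)/negP. Qed.

Lemma bt_anti s x y : B s x y -> B s y x -> x = y.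
Proof. by move=> h1 h2; have [_ /(bt_loop bB)] := bt_prefix bB h2 h1. Qed.

Lemma bt_antir x y t : B x y t -> B y x t -> x = y.
Proof. by move=> h1 h2; have [_ /(bt_loop bB)] := bt_suffix bB h1 h2. Qed.

(** Let x be attached to the block of the arc c -> d at a vertex g. Then d lies on the dipath from x
    to c only if g = d, and c on the one from d to x only if g = c. The proof compares d with the
    first arc c -> y of the dipath from c to x. *)
Lemma arc_not_hung c d x : e c d -> B x d c -> B d c x -> False.
Proof.
move=> ecd xdc dcx.
have cx : c != x.
  apply/eqP=> cx; move: xdc; rewrite -cx => /(bt_loop bB) dc.
  by move: ecd; rewrite dc => /bt_irrefl.
have [y ecy cyx] := bt_succ bB cx.
have [dcy dyx] : B d c y /\ B d y x.
  by have [] := bt_suffix bB dcx cyx.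
case: (bt_first bB d ecy) => [cyd|ycd].
  case: (bt_arc bB ecd cyd) => yE.
    by move: ecy; rewrite yE => /bt_irrefl.
  move: dcy; rewrite yE => /(bt_loop bB) cd.
  by move: ecd; rewrite cd => /bt_irrefl.
case: (bt_triangle bB x ycd) => h.
  have cy := bt_antir cyx h.
  by move: ecy; rewrite cy => /bt_irrefl.
have cd := bt_anti h xdc.
by move: ecd; rewrite cd => /bt_irrefl.
Qed.

Lemma two_arcs_between p x s : e p x -> e x s -> B p x s.
Proof.
move=> epx exs; case: (bt_first bB s epx) => // /(bt_arc bB exs)[] ps.
  by move: epx; rewrite ps => /bt_irrefl.
by rewrite ps in epx; case: (bt_asym epx exs).
Qed.

(** As x lies on the dipath from p to s, it lies on the dipath from p to z or on the one from z to
    s. Both contradict the given orders. *)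
Lemma two_arcs_not_hung p x s z : e p x -> e x s -> B x p z -> B z s x -> False.
Proof.
move=> epx exs xpz zsx.
case: (bt_triangle bB z (two_arcs_between epx exs)) => h.
  by have xp := bt_antir h xpz; move: epx; rewrite xp => /bt_irrefl.
by have xs := bt_anti h zsx; move: exs; rewrite xs => /bt_irrefl.
Qed.

(** The dipath from b to c avoids a and d, so it extends by one arc at either end to a dipath from a
    to d. *)
Lemma arcs_joined a b c d : e a b -> e c d -> a <> d -> ~ B b a c -> ~ B b d c ->
  [/\ B a b d, B a c d & B b c d].
Proof.
move=> eab ecd nad nbac nbdc.
have abc : B a b c by case: (bt_first bB c eab).
have bcd : B b c d by case: (bt_last bB b ecd).
have abd : B a b d.
  case: (bt_first bB d eab) => // bad.
  case: (bt_total bB bad bcd) => // bca.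
  have [_ cad] := bt_prefix bB bad bca.
  case: (bt_arc bB ecd cad) => // ac.
  by case: nbac; rewrite ac; apply: (bt_target bB).
by have [] := bt_suffix bB abd bcd.
Qed.

(** The ends [s] and [t] are not traversed, in agreement with the internal vertices of a rainbow
    path. The dipath from [a.1] to [a.2] being the arc itself, [B a.1 a.2 t] says that this arc is
    used to leave [a.1]. *)
Definition traversed s t (i : T + T * T) : bool :=
  match i with
  | inl x => [&& B s x t, x != s & x != t]
  | inr a => [&& e a.1 a.2, B s a.1 t & B a.1 a.2 t]
  end.

Definition compatible (i j : T + T * T) : Prop :=
  exists s t, traversed s t i /\ traversed s t j.

Lemma compatible_sym i j : compatible i j -> compatible j i.
Proof. by case=> s [t [ti tj]]; exists s, t. Qed.

Lemma traversed_arc s t a b : e a b -> B s a b -> B s b t -> traversed s t (inr (a, b)).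
Proof. by move=> eab sab sbt; rewrite /= eab; have [-> ->] := bt_prefix bB sbt sab. Qed.

Lemma traversed_vertex s t x : B s x t -> x <> s -> x <> t -> traversed s t (inl x).
Proof. by move=> sxt /eqP nxs /eqP nxt; rewrite /= sxt nxs. Qed.

End Betweenness.

(** The axioms are self-dual, so that each fact about arcs leaving [r] yields one about arcs
    entering it. *)
Lemma betweenness_rev (T : finType) (e : rel T) (B : T -> T -> T -> bool) :
  betweenness e B -> betweenness (fun x y => e y x) (fun s x t => B t x s).
Proof.
case=> o s t l tr pre suf tot arc fi la su pr; split => //.
- by move=> x y; apply: o.
- by move=> a x b z /(tr _ _ _ z)[]; [right | left].
- by move=> a x y b h1 h2; have [] := suf _ _ _ _ h1 h2.
- by move=> a x y b h1 h2; have [] := pre _ _ _ _ h1 h2.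
- move=> a x y b h1 h2; have [h|h] := tot _ _ _ _ h1 h2.
    by right; have [] := pre _ _ _ _ h2 h.
  by left; have [] := pre _ _ _ _ h1 h.
- by move=> a b x eba /(arc _ _ _ eba)[]; [right|left].
- by move=> a b z eba; have [] := la _ _ z eba; [left|right].
- by move=> a b z eba; have [] := fi _ _ z eba; [left|right].
- by move=> a b; rewrite eq_sym => /pr.
- by move=> a b; rewrite eq_sym => /su.
Qed.

(** * Betweenness given by the dipaths of a cactus *)

Section CactusBetween.
Variables (T : finType) (e : rel T).
Hypothesis cacte : cactus e.
Implicit Types a b s t u v w x y z : T.

(** The chosen dipath is the only one, so [betweenE] may evaluate this on any dipath at hand. *)
Definition between s x t : bool :=
  x \in s :: xchoose (dipath_exists cacte s t).

Lemma betweenE s t p x : dipath e s t p -> between s x t = (x \in s :: p).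
Proof.
move=> dp; congr (_ \in _ :: _).
by apply: (dipath_unique cacte) dp; apply: xchooseP.
Qed.

Lemma dipath_catP s t p1 p2 : dipath e s t (p1 ++ p2) ->
  dipath e s (last s p1) p1 /\ dipath e (last s p1) t p2.
Proof.
case/and3P; rewrite cat_path last_cat -cat_cons cat_uniq.
move=> /andP[e1 e2] lt /and3P[U1 /hasPn N U2].
rewrite /dipath e1 e2 eqxx lt U1 cons_uniq U2 andbT /=; split=> //.
by rewrite andbT; apply/negP=> /N; rewrite mem_last.
Qed.

Lemma betweenP s x t : between s x t -> exists p1 p2,
  [/\ dipath e s x p1, dipath e x t p2 & dipath e s t (p1 ++ p2)].
Proof.
have [p dp] := dipath_exists cacte s t.
rewrite (betweenE _ dp) => xp; case/splitPl: xp dp => p1 p2 lx dp.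
by exists p1, p2; have [] := dipath_catP dp; rewrite lx.
Qed.

Lemma dipath_arc a b : e a b -> dipath e a b [:: b].
Proof.
move=> eab; rewrite /dipath /= eab eqxx inE andbT /=.
by rewrite andbT; apply: contraTneq eab => ->; rewrite (cactus_loopless cacte).
Qed.

Lemma dipath_cons a b t p : e a b -> dipath e b t p -> a \notin b :: p ->
  dipath e a t (b :: p).
Proof. by move=> eab /and3P[ep lp Up] nap; rewrite /dipath /= eab ep lp nap. Qed.

Lemma dipath_rcons s a b p : e a b -> dipath e s a p -> b \notin s :: p ->
  dipath e s b (rcons p b).
Proof.
move=> eab /and3P[ep /eqP lp Up] nbp.
by rewrite /dipath rcons_path ep lp eab last_rcons eqxx -rcons_cons rcons_uniq nbp.
Qed.

Lemma between_betweenness : betweenness e between.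
Proof.
have prefix s x y t : between s x t -> between s y x -> between s y t /\ between y x t.
  move=> /betweenP[p1 [p2 [d1 d2 d]]].
  rewrite (betweenE _ d1) (betweenE _ d) => yp1.
  split; first by rewrite -cat_cons mem_cat yp1.
  case/splitPl: yp1 d1 d => q1 q2 ly d1; rewrite -catA => d.
  have [_ d'] := dipath_catP d; rewrite ly in d'.
  have [_ /and3P[_ /eqP lx _]] := dipath_catP d1.
  by rewrite (betweenE _ d') -cat_cons mem_cat -lx ly mem_last.
have suffix s x y t : between s x t -> between x y t -> between s y t /\ between s x y.
  move=> /betweenP[p1 [p2 [d1 d2 d]]].
  rewrite (betweenE _ d2) (betweenE _ d) => yp2.
  have lx : last s p1 = x by case/and3P: d1 => _ /eqP.
  split.
    move: yp2; rewrite -cat_cons mem_cat inE.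
    by case/predU1P=> [->|->]; rewrite ?orbT // -lx mem_last.
  case/splitPl: yp2 d2 d => q1 q2 ly d2; rewrite catA => d.
  have [d' _] := dipath_catP d; rewrite last_cat lx ly in d'.
  by rewrite (betweenE _ d') -cat_cons mem_cat -lx mem_last.
split=> //.
- exact: cactus_oriented cacte.
- by move=> s t; rewrite /between mem_head.
- move=> s t; have [p dp] := dipath_exists cacte s t.
  by rewrite (betweenE _ dp); case/and3P: dp => _ /eqP <- _; rewrite mem_last.
- move=> s x; have ds : dipath e s s [::] by rewrite /dipath /= eqxx.
  by rewrite (betweenE _ ds) inE => /eqP.
- move=> s x t z; have [p dp] := dipath_exists cacte s z.
  have [p' dp'] := dipath_exists cacte z t.
  rewrite (betweenE _ dp) (betweenE _ dp').
  have [ep /eqP lp _] := and3P dp; have [ep' /eqP lp' _] := and3P dp'.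
  (* The two dipaths in succession form a walk, which shortens to the dipath from [s] to [t]. *)
  have : path e s (p ++ p') by rewrite cat_path ep lp.
  have : last s (p ++ p') = t by rewrite last_cat lp.
  move=> lpp epp; move: lpp; case/shortenP: epp => q eq Uq sub lq.
  have dq : dipath e s t q by rewrite /dipath eq lq eqxx.
  rewrite (betweenE _ dq) inE => /predU1P[->|/sub]; first by left; rewrite inE eqxx.
  by rewrite mem_cat => /orP[] xp; [left|right]; rewrite inE xp orbT.
- move=> s x y t sxt; have [p1 [p2 [d1 d2 d]]] := betweenP sxt.
  rewrite (betweenE _ d) -cat_cons mem_cat => /orP[yp|yp].
    by right; rewrite (betweenE _ d1).
  left; have xyt : between x y t by rewrite (betweenE _ d2) inE yp orbT.
  by have [] := suffix _ _ _ _ sxt xyt.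
- move=> a b x eab; rewrite (betweenE _ (dipath_arc eab)) !inE.
  by move=> /orP[]/eqP; [left|right].
- move=> a b t eab; have [p dp] := dipath_exists cacte b t.
  rewrite (betweenE _ dp); have [|nap] := boolP (a \in b :: p); first by right.
  by left; rewrite (betweenE _ (dipath_cons eab dp nap)) !inE eqxx orbT.
- move=> a b s eab; have [p dp] := dipath_exists cacte s a.
  rewrite (betweenE b dp); have [|nbp] := boolP (b \in s :: p); first by right.
  rewrite (betweenE _ (dipath_rcons eab dp nbp)); left.
  by case/and3P: dp => _ /eqP <- _; rewrite -rcons_cons mem_rcons inE mem_last orbT.
- move=> s t st; have [p dp] := dipath_exists cacte s t.
  case: p dp => [|y p] dp; first by case/and3P: dp => _ /= /idPn[].
  by exists y; [case/and3P: dp => /= /andP[] | rewrite (betweenE _ dp) !inE eqxx orbT].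
- move=> s t st; have [p dp] := dipath_exists cacte s t.
  case/lastP: p dp => [|p y] dp; first by case/and3P: dp => _ /= /idPn[].
  have [] := and3P dp; rewrite rcons_path last_rcons => /andP[_ ey] /eqP yt _.
  rewrite yt in ey; exists (last s p) => //.
  by rewrite (betweenE _ dp) -rcons_cons mem_rcons inE mem_last orbT.
Qed.

End CactusBetween.

(** * Arcs off the gates *)

(* The arc a b does not touch the gate of its block towards r. *)
Definition off_gate (T : finType) (e : rel T) (B : T -> T -> T -> bool) (r a b : T) :=
  [&& e a b, B a b r & B r a b].

Section OffGate.
Variables (T : finType) (e : rel T) (B : T -> T -> T -> bool).
Hypothesis bB : betweenness e B.
Variable r : T.
Implicit Types a b c d k l p s t u v w x y z : T.
Local Notation off := (off_gate e B r).
Local Notation irr := (bt_irrefl bB).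

Lemma off_gateP a b : reflect [/\ e a b, B a b r & B r a b] (off a b).
Proof. exact: and3P. Qed.

Lemma towards_root a b c : e a b -> B a b r -> B b a c -> B r a c.
Proof.
move=> eab abr bac; case: (bt_triangle bB r bac) => // bar.
by have ab := bt_antir bB abr bar; move: eab; rewrite ab => /irr.
Qed.

Lemma from_root a b c : e a b -> B r a b -> B c b a -> B c b r.
Proof.
move=> eab rab cba; case: (bt_triangle bB r cba) => // rba.
by have ab := bt_anti bB rab rba; move: eab; rewrite ab => /irr.
Qed.

Lemma same_succ p x y : e p x -> e p y -> B p x r -> B p y r -> x = y.
Proof.
move=> epx epy pxr pyr; case: (bt_total bB pxr pyr) => h.
  case: (bt_arc bB epy h) => // xp; by move: epx; rewrite xp => /irr.
case: (bt_arc bB epx h) => // yp; by move: epy; rewrite yp => /irr.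
Qed.

Lemma same_pred s x y : e x s -> e y s -> B r x s -> B r y s -> x = y.
Proof.
move=> exs eys rxs rys; case: (bt_total bB rxs rys) => h.
  have [_ h'] := bt_prefix bB rys h.
  case: (bt_arc bB exs h') => // xs; by move: eys; rewrite xs => /irr.
have [_ h'] := bt_prefix bB rxs h.
case: (bt_arc bB eys h') => // ys; by move: exs; rewrite ys => /irr.
Qed.

Lemma off_gate_head a b : off a b -> b <> r.
Proof.
case/off_gateP=> eab _ rab br; rewrite br in rab eab.
by have ar := bt_loop bB rab; move: eab; rewrite ar => /irr.
Qed.

Lemma joined_compatible a b c d : e a b -> e c d -> a <> d ->
  ~ B b a c -> ~ B b d c -> compatible e B (inr (a, b)) (inr (c, d)).
Proof.
move=> eab ecd nad nbac nbdc.
have [abd acd _] := arcs_joined bB eab ecd nad nbac nbdc.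
by exists a, d; split; apply: traversed_arc => //; rewrite ?(bt_source bB) ?(bt_target bB).
Qed.

(** Consecutive arcs form a dipath. Otherwise [arcs_joined] is tried in both orders. Each order has
    two possible obstructions, and each of the four ways of obstructing both orders is
    contradictory. *)
Lemma off_gate_arcs_compatible a b c d : off a b -> off c d -> (a, b) <> (c, d) ->
  compatible e B (inr (a, b)) (inr (c, d)).
Proof.
case/off_gateP=> eab abr rab; case/off_gateP=> ecd cdr rcd nE.
have [ad|/eqP nad] := eqVneq a d.
  move: ecd cdr rcd nE; rewrite -{}ad => eca car rca _.
  exists c, b; have cab := two_arcs_between bB eca eab.
  by split; apply: traversed_arc => //; rewrite ?(bt_source bB) ?(bt_target bB).
have [cb|/eqP ncb] := eqVneq c b.
  move: ecd cdr rcd nE nad; rewrite {}cb => ebd bdr rbd _ _.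
  exists a, d; have abd := two_arcs_between bB eab ebd.
  by split; apply: traversed_arc => //; rewrite ?(bt_source bB) ?(bt_target bB).
(* Here b and d each lie on the dipath from the other to [r], so they are equal, and only one arc
   enters this vertex on the dipath from [r]. *)
have heads : B b d c -> B d b a -> False.
  move=> bdc dba; have bdr := from_root ecd rcd bdc; have dbr := from_root eab rab dba.
  have bd := bt_antir bB bdr dbr; subst d.
  by apply: nE; rewrite (same_pred eab ecd rab rcd).
have [|/negP nbac] := boolP (B b a c); last have [|/negP nbdc] := boolP (B b d c).
- move=> bac; have [|/negP ndca] := boolP (B d c a); last have [|/negP ndba] := boolP (B d b a).
  + move=> dca; have rac := towards_root eab abr bac; have rca := towards_root ecd cdr dca.
    have ac := bt_anti bB rac rca; subst c.
    by case: nE; rewrite (same_succ eab ecd abr cdr).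
  + move=> dba; case: (bt_last bB b ecd) => [bcd|bdc]; last by case: (heads bdc dba).
    by have [bad _] := bt_prefix bB bcd bac; case: (arc_not_hung bB eab dba bad).
  + by apply: compatible_sym; apply: joined_compatible.
- move=> bdc; have [|/negP ndca] := boolP (B d c a); last have [|/negP ndba] := boolP (B d b a).
  + move=> dca; case: (bt_last bB d eab) => [dab|dba]; last by case: (heads bdc dba).
    by have [dcb _] := bt_prefix bB dab dca; case: (arc_not_hung bB ecd bdc dcb).
  + by move=> dba; case: (heads bdc dba).
  + by apply: compatible_sym; apply: joined_compatible.
- exact: joined_compatible.
Qed.

(** The vertex x is internal once p -> x is joined ahead of c -> d ([join1]) or c -> d ahead of x ->
    s ([join2]). Shared endpoints are settled first; after that the two orders cannot both be
    obstructed. *)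
Lemma off_gate_vertex_arc_compatible p x s c d : off p x -> off x s -> off c d ->
  compatible e B (inl x) (inr (c, d)).
Proof.
move=> offpx; have xr := off_gate_head offpx.
case/off_gateP: offpx => epx pxr rpx.
case/off_gateP=> exs xsr rxs; case/off_gateP=> ecd cdr rcd.
have xs : x <> s by move=> xs; move: exs; rewrite xs => /irr.
have xp : x <> p by move=> xp; move: epx; rewrite xp => /irr.
have [xc|/eqP nxc] := eqVneq x c.
  subst c; exists p, d; have pxd := two_arcs_between bB epx ecd.
  split; last by apply: traversed_arc => //; apply: (bt_target bB).
  by apply: traversed_vertex => // xd; move: ecd; rewrite xd => /irr.
have [xd|/eqP nxd] := eqVneq x d.
  subst d; exists c, s; have cxs := two_arcs_between bB ecd exs.
  split; last by apply: traversed_arc => //; apply: (bt_source bB).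
  by apply: traversed_vertex.
have [pd|/eqP npd] := eqVneq p d.
  subst d; exists r, s; split; first by apply: traversed_vertex.
  apply: traversed_arc => //.
  by have [] := bt_prefix bB rxs rpx.
have [cs|/eqP ncs] := eqVneq c s.
  subst c; exists r, d; split; last by apply: traversed_arc => //; apply: (bt_target bB).
  by apply: traversed_vertex => //; have [] := bt_prefix bB rcd rxs.
have heads : B x d c -> B d s x -> False.
  move=> xdc dsx; have xdr := from_root ecd rcd xdc; have dsr := from_root exs rxs dsx.
  have [_ xds] := bt_suffix bB xdr dsr.
  case: (bt_arc bB exs xds) => [dx|ds]; first exact: nxd.
  by subst d; apply: nxc; apply: (same_pred exs ecd).
have join1 : ~ B x p c -> ~ B x d c -> compatible e B (inl x) (inr (c, d)).
  move=> h1 h2; have [pxd pcd _] := arcs_joined bB epx ecd npd h1 h2.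
  exists p, d; split; first by apply: traversed_vertex.
  by apply: traversed_arc => //; apply: (bt_target bB).
have join2 : ~ B d c x -> ~ B d s x -> compatible e B (inl x) (inr (c, d)).
  move=> h1 h2; have [cds cxs' _] := arcs_joined bB ecd exs ncs h1 h2.
  exists c, s; split; first by apply: traversed_vertex.
  by apply: traversed_arc => //; apply: (bt_source bB).
have [|/negP nxdc] := boolP (B x d c).
  move=> xdc; apply: join2; first by move=> /(arc_not_hung bB ecd xdc).
  by move=> /(heads xdc).
have [|/negP nxpc] := boolP (B x p c); last exact: join1.
move=> xpc; apply: join2.
  move=> dcx; have rpc := towards_root epx pxr xpc; have rcx := towards_root ecd cdr dcx.
  have [_ pcx] := bt_prefix bB rcx rpc.
  case: (bt_arc bB epx pcx) => [cp|cx]; last exact: nxc.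
  by subst c; apply: nxd; apply: (same_succ epx ecd).
move=> dsx; case: (bt_last bB x ecd) => // xcd.
have [xpd _] := bt_prefix bB xcd xpc.
exact: (two_arcs_not_hung bB epx exs xpd dsx).
Qed.

(** If one vertex lies on the dipath from [r] to the other, this dipath prolonged by one arc
    traverses both. Otherwise the arc into one vertex is joined ahead of the arc out of the other,
    in one of the two orders. *)
Lemma off_gate_vertices_compatible p x s p' y s' :
    off p x -> off x s -> off p' y -> off y s' -> x <> y ->
  compatible e B (inl x) (inl y).
Proof.
move=> offpx; have xr := off_gate_head offpx.
case/off_gateP: offpx => epx pxr rpx.
case/off_gateP=> exs xsr rxs.
move=> offpy; have yr := off_gate_head offpy.
case/off_gateP: offpy => epy pyr rpy.
case/off_gateP=> eys ysr rys nxy.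
have xs : x <> s by move=> xs; move: exs; rewrite xs => /irr.
have xp : x <> p by move=> xp; move: epx; rewrite xp => /irr.
have ys : y <> s' by move=> ys; move: eys; rewrite ys => /irr.
have yp : y <> p' by move=> yp; move: epy; rewrite yp => /irr.
have [ryx|/negP nryx] := boolP (B r y x).
  exists r, s; split; apply: traversed_vertex => //.
    by have [] := bt_prefix bB rxs ryx.
  by move=> yS; subst s; apply: nxy; apply: (bt_anti bB rxs ryx).
have [rxy|/negP nrxy] := boolP (B r x y).
  exists r, s'; split; apply: traversed_vertex => //.
    by have [] := bt_prefix bB rys rxy.
  by move=> xS; subst s'; apply: nxy; apply: (bt_anti bB rxy rys).
have join1 : ~ B x p y -> ~ B x s' y -> compatible e B (inl x) (inl y).
  move=> h1 h2; have nps : p <> s'.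
    by move=> ps; subst s'; apply: nryx; have [] := bt_prefix bB rpx rys.
  have [h3 h4 _] := arcs_joined bB epx eys nps h1 h2.
  exists p, s'; split; apply: traversed_vertex => //.
    by move=> xS; subst s'; apply: nryx.
  by move=> yP; subst p; apply: nryx.
have join2 : ~ B y p' x -> ~ B y s x -> compatible e B (inl x) (inl y).
  move=> h1 h2; have nps : p' <> s.
    by move=> ps; subst s; apply: nrxy; have [] := bt_prefix bB rpy rxs.
  have [h3 h4 _] := arcs_joined bB epy exs nps h1 h2.
  exists p', s; split; apply: traversed_vertex => //.
    by move=> xP; subst p'; apply: nrxy.
  by move=> yS; subst s; apply: nrxy.
have [|/negP nxpy] := boolP (B x p y).
  move=> xpy; apply: join2; last by move=> /(two_arcs_not_hung bB epx exs xpy).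
  move=> ypx; have rpy' := towards_root epx pxr xpy; have rpx' := towards_root epy pyr ypx.
  have same : p = p' -> False.
    by move=> pp; subst p'; apply: nxy; apply: (same_succ epx epy).
  case: (bt_total bB rpy rpy') => h.
    have [_ h'] := bt_prefix bB rpy' h.
    by case: (bt_arc bB epy h') => [/same|py] //; subst p.
  have [_ h'] := bt_prefix bB rpx' h.
  by case: (bt_arc bB epx h') => [/esym/same|py] //; subst p'.
have [|/negP nxsy] := boolP (B x s' y); last exact: join1.
move=> xsy; apply: join2.
  by move=> ypx; apply: (two_arcs_not_hung bB epy eys ypx xsy).
move=> ysx; have xsr' := from_root eys rys xsy; have ysr' := from_root exs rxs ysx.
have same : s = s' -> False.
  by move=> ss; subst s'; apply: nxy; apply: (same_pred exs eys).
case: (bt_total bB xsr xsr') => h.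
  have [_ h'] := bt_prefix bB xsr' h.
  have [_ h2] := bt_suffix bB ysr' h'.
  by case: (bt_arc bB eys h2) => [sy|/same] //; subst s.
by case: (bt_arc bB exs h) => [sx|/esym/same] //; subst s'.
Qed.

End OffGate.

(** * Passing from one block to another *)

Section Pivot.
Variables (T : finType) (e : rel T) (B : T -> T -> T -> bool).
Hypothesis bB : betweenness e B.
Variables k r l : T.
Hypotheses (ekr : e k r) (erl : e r l) (nrlk : ~ B r l k).
Implicit Types a b c d p s t u v w x y z : T.
Local Notation off := (off_gate e B r).
Local Notation irr := (bt_irrefl bB).

Lemma pivot_tail_neq_head : k <> l.
Proof. by move=> kl; apply: (bt_asym bB erl); rewrite -kl. Qed.

(** The dipath from [r] to b passes through [l], hence avoids [k], and k -> r extends it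
    backwards. *)
Lemma pivot_before a b : off a b -> B r l a ->
  [/\ traversed e B k b (inr (a, b)), traversed e B k b (inl r),
      traversed e B k b (inl l), traversed e B k b (inr (r, l)) &
      B k a b /\ a <> k].
Proof.
case/off_gateP=> eab abr rab rla.
have [rlb lab] := bt_prefix bB rab rla.
have nrk c : B r l c -> ~ B r k c.
  move=> rlc rkc; case: (bt_total bB rkc rlc) => // rkl.
  case: (bt_arc bB erl rkl) => [kr|]; last exact: pivot_tail_neq_head.
  by move: ekr; rewrite kr => /irr.
have krb : B k r b by case: (bt_first bB b ekr) => // /(nrk _ rlb).
have [klb krl] := bt_suffix bB krb rlb.
have [kab _] := bt_suffix bB krb rab.
split.
- by apply: traversed_arc => //; apply: (bt_target bB).
- apply: traversed_vertex => // [rk|rb]; first by move: ekr; rewrite rk => /irr.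
  rewrite -rb in rlb; have lr := bt_loop bB rlb.
  by move: erl; rewrite lr => /irr.
- apply: traversed_vertex => // [lk|lb]; first exact: (pivot_tail_neq_head (esym lk)).
  rewrite -lb in rab eab; have al := bt_anti bB rab rla.
  by move: eab; rewrite al => /irr.
- exact: traversed_arc.
- by split=> // ak; rewrite ak in rla.
Qed.

(** The dipath from a to [r] avoids [l] by [arc_not_hung], and is prolonged by r -> l -> l1. *)
Lemma pivot_after l1 a b : e l l1 -> off a b -> ~ B r l a ->
  [/\ traversed e B a l1 (inr (a, b)), traversed e B a l1 (inl r),
      traversed e B a l1 (inl l), traversed e B a l1 (inr (r, l)) &
      B a b l1 /\ b <> l1].
Proof.
move=> ell1 /off_gateP[eab abr rab] nrla.
have lra : B l r a by case: (bt_first bB a erl).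
have nalr : ~ B a l r by move=> alr; apply: (arc_not_hung bB erl alr lra).
have arl : B a r l by case: (bt_last bB a erl).
have nall : ~ B a l1 l by move=> /(two_arcs_not_hung bB erl ell1 lra).
have all1 : B a l l1 by case: (bt_last bB a ell1).
have [arl1 rll1] := bt_prefix bB all1 arl.
have [abl1 brl1] := bt_prefix bB arl1 abr.
have na c : B a c r -> c <> l1.
  by move=> acr cl; subst c; have [] := bt_prefix bB arl acr.
split.
- by apply: traversed_arc => //; apply: (bt_source bB).
- apply: traversed_vertex => // [ra|rl1].
    rewrite ra in abr; have ba := bt_loop bB abr.
    by move: eab; rewrite ba => /irr.
  by move: ell1; rewrite -rl1 => /(bt_asym bB erl).
- apply: traversed_vertex => // [la|ll1].
    by apply: nrla; rewrite -la; apply: (bt_target bB).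
  by move: ell1; rewrite -ll1 => /irr.
- exact: traversed_arc.
- by split=> //; apply: na.
Qed.

Lemma off_gate_arc_pivot a b : off a b ->
  exists s t, [/\ traversed e B s t (inr (a, b)), traversed e B s t (inl r),
      traversed e B s t (inl l) & traversed e B s t (inr (r, l))].
Proof.
move=> oab; have nlr : l != r by apply/eqP=> lr; move: erl; rewrite lr => /irr.
have [l1 ell1 _] := bt_succ bB nlr.
have [rla|/negP nrla] := boolP (B r l a).
  by have [] := pivot_before oab rla; exists k, b.
by have [] := pivot_after ell1 oab nrla; exists a, l1.
Qed.

Lemma off_gate_vertex_pivot p x s : off p x -> off x s ->
  exists s t, [/\ traversed e B s t (inl x), traversed e B s t (inl r),
      traversed e B s t (inl l) & traversed e B s t (inr (r, l))].
Proof.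
move=> opx oxs; have nlr : l != r by apply/eqP=> lr; move: erl; rewrite lr => /irr.
have [l1 ell1 _] := bt_succ bB nlr.
have [epx pxr rpx] := off_gateP _ _ _ _ _ opx.
have [exs _ _] := off_gateP _ _ _ _ _ oxs.
have [rlx|/negP nrlx] := boolP (B r l x).
  have [_ tr tl ta [kxs xk]] := pivot_before oxs rlx; exists k, s; split=> //.
  by apply: traversed_vertex => // xs; move: exs; rewrite xs => /irr.
have nrlp : ~ B r l p by move=> rlp; have [] := bt_prefix bB rpx rlp.
have [_ tr tl ta [pxl xl1]] := pivot_after ell1 opx nrlp; exists p, l1; split=> //.
by apply: traversed_vertex => // xp; move: epx; rewrite xp => /irr.
Qed.

(** The dipath is k0 -> k -> r -> l -> l1, with arbitrary care needed only at its ends: [l1] follows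
    [l] on the way to [r], and [k0] precedes [k] on the way from [r]. *)
Lemma pivot_path : exists s t,
  [/\ traversed e B s t (inl k), traversed e B s t (inl r), traversed e B s t (inl l),
      traversed e B s t (inr (k, r)) & traversed e B s t (inr (r, l))].
Proof.
have nlr : l != r by apply/eqP=> lr; move: erl; rewrite lr => /irr.
have nrk : r != k by apply/eqP=> rk; move: ekr; rewrite rk => /irr.
have [l1 ell1 _] := bt_succ bB nlr.
have [k0 ekk0 _] := bt_pred bB nrk.
have rk c : B r k c -> B r l c -> False.
  move=> rkc rlc; case: (bt_total bB rkc rlc) => // rkl.
  by case: (bt_arc bB erl rkl) => [/esym/eqP|/pivot_tail_neq_head //]; rewrite (negPf nrk).
have rll1 := two_arcs_between bB erl ell1.
have k0kr := two_arcs_between bB ekk0 ekr.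
have krl := two_arcs_between bB ekr erl.
have krl1 : B k r l1 by case: (bt_first bB l1 ekr) => // /rk /(_ rll1).
have [kll1 _] := bt_suffix bB krl1 rll1.
(* If [k0] did not extend k -> r -> l -> l1 backwards, it would lie on it. Each position gives a
   loop, a pair of opposite arcs, [l] on the dipath from [r] to [k], or [k] and [l] on one dipath
   from [r]. *)
have k0kl1 : B k0 k l1.
  case: (bt_first bB l1 ekk0) => // kk0l1; exfalso.
  case: (bt_total bB kk0l1 krl1) => [kk0r|krk0].
    case: (bt_arc bB ekr kk0r) => k0E; first by move: ekk0; rewrite k0E => /irr.
    by move: ekk0; rewrite k0E => /(bt_asym bB ekr).
  have [_ rk0l1] := bt_prefix bB kk0l1 krk0.
  case: (bt_total bB rk0l1 rll1) => [rk0l|rlk0].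
    case: (bt_arc bB erl rk0l) => k0E; rewrite k0E in ekk0; first exact: (bt_asym bB ekr).
    by apply: nrlk; apply: two_arcs_between ekk0.
  case: (bt_last bB r ekk0) => [rk0k|rkk0].
    by apply: nrlk; have [] := bt_prefix bB rk0k rlk0.
  by have [/rk /(_ rll1)] := bt_prefix bB rk0l1 rkk0.
have [k0rl1 _] := bt_suffix bB k0kl1 krl1.
have [k0ll1 k0rl] := bt_suffix bB k0rl1 rll1.
exists k0, l1; split.
- apply: traversed_vertex => // kE; first by move: ekk0; rewrite kE => /irr.
  by rewrite -kE in krl1; have /esym/eqP := bt_loop bB krl1; rewrite eq_sym (negPf nrk).
- apply: traversed_vertex => // rE; last by move: ell1; rewrite -rE => /(bt_asym bB erl).
  by move: ekk0; rewrite -rE => /(bt_asym bB ekr).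
- apply: traversed_vertex => // lE; last by move: ell1; rewrite -lE => /irr.
  by apply: nrlk; rewrite lE; case: (bt_last bB r ekk0) => // rkk0;
     case: (rk k0) => //; rewrite -lE; apply: (bt_target bB).
- by apply: traversed_arc => //; have [] := bt_prefix bB k0rl1 k0kr.
- exact: traversed_arc.
Qed.

End Pivot.

Definition swap_item (T : Type) (i : T + T * T) : T + T * T :=
  match i with inl x => inl x | inr a => inr (a.2, a.1) end.

(** * Pairwise compatibility of the off-gate and pivot items *)

Section PivotClique.
Variables (T : finType) (e : rel T) (B : T -> T -> T -> bool).
Hypothesis bB : betweenness e B.
Variables k r l : T.
Hypotheses (ekr : e k r) (erl : e r l) (nrlk : ~ B r l k).
Implicit Types a b c d p s t u v w x y z : T.
Local Notation off := (off_gate e B r).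
Local Notation irr := (bt_irrefl bB).
Let e' x y := e y x.
Let B' s x t := B t x s.
Let bB' : betweenness e' B' := betweenness_rev bB.

Lemma traversed_rev s t i : traversed e' B' s t i -> traversed e B t s (swap_item i).
Proof.
case: i => [x|[b a]] /=; first by rewrite /B' [(x != s) && _]andbC.
rewrite /e' /B' => /and3P[eab tbs tab].
by have [tas abs] := bt_prefix bB tbs tab; rewrite eab tas.
Qed.

Lemma off_gate_rev a b : off_gate e' B' r b a = off a b.
Proof. by rewrite /off_gate /e' /B' [B r a b && _]andbC. Qed.

(** Reversal exchanges [k] and [l]; this is the pivot hypothesis for l, r, k in the reversed
    digraph. *)
Lemma pivot_rev : ~ B' r k l.
Proof.
rewrite /B' => lkr; case: (bt_first bB k erl) => // lrk.
by have rk := bt_anti bB lrk lkr; move: ekr; rewrite rk => /irr.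
Qed.

Lemma off_gate_arc_pivot_in a b : off a b ->
  exists s t, [/\ traversed e B s t (inr (a, b)), traversed e B s t (inl r),
      traversed e B s t (inl k) & traversed e B s t (inr (k, r))].
Proof.
rewrite -off_gate_rev => oba.
have [s [t []]] := off_gate_arc_pivot bB' erl ekr pivot_rev oba.
by do 4![move/traversed_rev=> ?]; exists t, s.
Qed.

Lemma off_gate_vertex_pivot_in p x s : off p x -> off x s ->
  exists s t, [/\ traversed e B s t (inl x), traversed e B s t (inl r),
      traversed e B s t (inl k) & traversed e B s t (inr (k, r))].
Proof.
rewrite -!off_gate_rev => opx oxs.
have [s0 [t []]] := off_gate_vertex_pivot bB' erl ekr pivot_rev oxs opx.
by do 4![move/traversed_rev=> ?]; exists t, s0.
Qed.

Definition off_gate_vertices : {set T} :=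
  [set x | [exists p, off p x] && [exists s, off x s]].

Definition off_gate_items : {set T + T * T} :=
  [set i | match i with inl x => x \in off_gate_vertices | inr a => off a.1 a.2 end].

Definition pivot_items : {set T + T * T} :=
  [set inl k; inl r; inl l; inr (k, r); inr (r, l)].

Lemma off_gate_verticesP x :
  reflect (exists p s, off p x /\ off x s) (x \in off_gate_vertices).
Proof.
rewrite inE; apply: (iffP andP) => [[/existsP[p ?] /existsP[s ?]]|[p [s [? ?]]]].
  by exists p, s.
by split; apply/existsP; [exists p|exists s].
Qed.

Lemma off_gate_pivot_compatible i j :
  i \in off_gate_items -> j \in pivot_items -> compatible e B i j.
Proof.
move=> iS; have [s [t [i1 r1 l1 rl1]]] : exists s t,
    [/\ traversed e B s t i, traversed e B s t (inl r),
        traversed e B s t (inl l) & traversed e B s t (inr (r, l))].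
  case: i iS => [x|[a b]]; rewrite inE; last first.
    exact: (off_gate_arc_pivot bB ekr erl nrlk).
  case/off_gate_verticesP=> p [s [opx oxs]].
  exact: (off_gate_vertex_pivot bB ekr erl nrlk opx oxs).
have [s' [t' [i2 r2 k2 kr2]]] : exists s t,
    [/\ traversed e B s t i, traversed e B s t (inl r),
        traversed e B s t (inl k) & traversed e B s t (inr (k, r))].
  case: i iS {i1} => [x|[a b]]; rewrite inE; last exact: off_gate_arc_pivot_in.
  by case/off_gate_verticesP=> p [s0 [opx oxs]]; apply: off_gate_vertex_pivot_in opx oxs.
by rewrite !inE -!orbA => /or4P[|||/orP[]] /eqP ->;
  [exists s', t'|exists s, t|exists s, t|exists s', t'|exists s, t].
Qed.

Lemma clique_compatible i j :
    i \in off_gate_items :|: pivot_items -> j \in off_gate_items :|: pivot_items ->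
  i != j -> compatible e B i j.
Proof.
have inl_items x : (inl x \in off_gate_items) = (x \in off_gate_vertices) by rewrite inE.
have inr_items a b : (inr (a, b) \in off_gate_items) = off a b by rewrite inE.
case/setUP=> iS /setUP[]jS nij.
- case: i j iS jS nij => [x|[a b]] [y|[c d]]; rewrite ?inl_items ?inr_items.
  + move=> /off_gate_verticesP[p [s [o1 o2]]] /off_gate_verticesP[p' [s' [o3 o4]]] nxy.
    by apply: off_gate_vertices_compatible o1 o2 o3 o4 _ => // xy; rewrite xy eqxx in nxy.
  + move=> /off_gate_verticesP[p [s [o1 o2]]] o3 _.
    exact: off_gate_vertex_arc_compatible o1 o2 o3.
  + move=> o3 /off_gate_verticesP[p [s [o1 o2]]] _; apply: compatible_sym.
    exact: off_gate_vertex_arc_compatible o1 o2 o3.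
  + move=> o1 o2 nE; apply: off_gate_arcs_compatible o1 o2 _ => // E.
    by rewrite E eqxx in nE.
- exact: off_gate_pivot_compatible.
- by apply: compatible_sym; apply: off_gate_pivot_compatible.
have [s [t [h1 h2 h3 h4 h5]]] := pivot_path bB ekr erl nrlk.
have all_traversed (m : T + T * T) : m \in pivot_items -> traversed e B s t m.
  by rewrite !inE -!orbA => /or4P[|||/orP[]] /eqP ->.
by exists s, t; split; apply: all_traversed.
Qed.

End PivotClique.

(** * Counting and lower bounds *)

Lemma uniq_map_inj (X Y : eqType) (f : X -> Y) (s : seq X) :
  uniq (map f s) -> {in s &, injective f}.
Proof.
elim: s => //= x s IH /andP[fxs /IH inj] y z; rewrite !inE.
case/predU1P=> [->|ys] /predU1P[->|zs] // fE; last exact: inj.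
  by rewrite fE map_f in fxs.
by rewrite -fE map_f in fxs.
Qed.

(** The number of vertices on the dipath from [r] grows strictly along the arcs of the out-tree, so
    the arc leaving a vertex of the cycle farthest from [r] is not in that tree. *)
Lemma directed_cycle_exit (T : finType) (e : rel T) (B : T -> T -> T -> bool) r C :
  betweenness e B -> directed_cycle e C -> exists2 a, a \in C & ~~ B r a.1 a.2.
Proof.
move=> bB [c [nc /andP[ec Uc] ->]].
case: c nc ec Uc => // x0 c _ ec Uc; set cy := x0 :: c.
have x0c : x0 \in cy by rewrite mem_head.
case: (@arg_maxnP _ x0 [in cy] (fun x => #|[set z | B r z x]|) x0c) => x xc maxx.
exists (x, next cy x); first by rewrite -cycle_arcs_mem.
apply/negP; rewrite -[(_, _).1]/x -[(_, _).2]/(next cy x) => rxn.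
have nc : next cy x \in cy by rewrite mem_next.
have exn : e x (next cy x) := next_cycle ec xc.
have := maxx _ nc; rewrite /geq /= leqNgt => /negP; apply; apply: proper_card.
apply/properP; split.
  by apply/subsetP=> z; rewrite !inE => rzx; have [] := bt_prefix bB rxn rzx.
exists (next cy x); rewrite !inE ?(bt_target bB) //.
apply/negP=> rnx; have xn := bt_anti bB rxn rnx.
by move: exn; rewrite -xn => /(bt_irrefl bB).
Qed.

Section Counting.
Variables (T : finType) (e : rel T).
Hypothesis cacte : cactus e.
Implicit Types a b c d s t u v w x y z : T.
Local Notation B := (between cacte).
Local Notation bB := (between_betweenness cacte).

(** Rotated so as to start at b, the cycle is the dipath from b to a, and it runs through every
    other arc of the cycle. *)
Lemma directed_cycle_between C a b c d : directed_cycle e C ->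
  (a, b) \in C -> (c, d) \in C -> (a, b) <> (c, d) -> B b c d /\ B b d a.
Proof.
case=> cy [_ /andP[ecy Ucy] ->]; rewrite !inE /= => /andP[acy /eqP bE].
have bcy : b \in cy by rewrite bE mem_next.
case/andP=> ccy /eqP dE nE.
have [i s rotE] := rot_to bcy.
have {}bE : b = next (b :: s) a by rewrite -rotE next_rot.
have {}dE : d = next (b :: s) c by rewrite -rotE next_rot.
have nca : c <> a by move=> ca; apply: nE; rewrite dE {1}bE ca.
have Us : uniq (b :: s) by rewrite -rotE rot_uniq.
have es : path e b (rcons s b) by have : cycle e (b :: s) by rewrite -rotE rot_cycle.
have ns : path (frel (next (b :: s))) b (rcons s b) by exact: cycle_next Us.
move: es; rewrite rcons_path => /andP[es _].
have aE : a = last b s.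
  apply: (can_inj (prev_next Us)); rewrite -bE.
  by move: ns; rewrite rcons_path => /andP[_ /eqP].
have ds : dipath e b a s by rewrite /dipath es aE eqxx.
have {ccy} : c \in b :: s by rewrite -rotE mem_rot.
move=> cs; case/splitPl: cs ns aE ds dE => p1 p2 lc.
case: p2 => [|d' p2].
  by rewrite cats0 lc => _ ac; case: nca.
rewrite rcons_cat cat_path /= lc => /and3P[_ /eqP nc _] _ dp dE.
rewrite {}nc in dE; subst d'; rewrite -cat_rcons in dp.
have [dp1 _] := dipath_catP dp; rewrite last_rcons in dp1.
rewrite (betweenE _ _ dp1) (betweenE _ _ dp).
rewrite -rcons_cons mem_rcons inE -lc mem_last orbT; split=> //.
by rewrite -cat_cons mem_cat -rcons_cons mem_rcons mem_head.
Qed.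

Variables (P : {set {set T * T}}).
Hypotheses (partP : partition P (arcs e)) (cycP : forall C, C \in P -> directed_cycle e C).

Lemma block_arcs_between C a b c d : C \in P -> (a, b) \in C -> (c, d) \in C ->
  (a, b) <> (c, d) -> B b c d /\ B b d a.
Proof. by move=> /cycP; apply: directed_cycle_between. Qed.

Variable r : T.

Definition nonout_arcs := [set a in arcs e | ~~ B r a.1 a.2].
Definition nonin_arcs := [set a in arcs e | ~~ B a.1 a.2 r].

Let trivP : trivIset P. Proof. by case/and3P: partP. Qed.
Let coverP (a : T * T) : (a \in cover P) = e a.1 a.2.
Proof. by case/and3P: partP => /eqP -> _ _; rewrite inE. Qed.

(** Two arcs of a block follow each other around its cycle. If this is impossible within [A], then
    [A] has at most one arc in each block. *)
Lemma pblock_inj_arcs (A : {set T * T}) : A \subset arcs e ->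
  (forall a b c d, (a, b) \in A -> (c, d) \in A -> (a, b) <> (c, d) ->
     B b c d -> B b d a -> B d a b -> B d b c -> False) ->
  {in A &, injective (pblock P)}.
Proof.
move=> /subsetP sA disj [a b] [c d] aA cA /= pE; apply/eqP/negPn/negP=> /eqP nE.
have aP : (a, b) \in cover P by rewrite coverP; have := sA _ aA; rewrite inE.
have cP : (c, d) \in cover P by rewrite coverP; have := sA _ cA; rewrite inE.
have CP := pblock_mem aP.
have aC : (a, b) \in pblock P (a, b) by rewrite mem_pblock.
have cC : (c, d) \in pblock P (a, b) by rewrite pE mem_pblock.
have [h1 h2] := block_arcs_between CP aC cC nE.
have [h3 h4] := block_arcs_between CP cC aC (fun E => nE (esym E)).
exact: disj aA cA nE h1 h2 h3 h4.
Qed.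

Lemma card_pblock_image (A : {set T * T}) :
  A \subset arcs e -> {in A &, injective (pblock P)} -> #|A| <= #|P|.
Proof.
move=> /subsetP sA injA; rewrite -(card_in_imset injA); apply: subset_leq_card.
apply/subsetP=> _ /imsetP[a aA ->]; apply: pblock_mem.
by rewrite coverP; have := sA _ aA; rewrite inE.
Qed.

(** Each block has at least one such arc by [directed_cycle_exit]. It has no second one: if b
    precedes a on the dipath from [r], this dipath follows the block from b to a and contains its
    other arcs. *)
Lemma card_nonout_arcs : #|nonout_arcs| = #|P|.
Proof.
have sub : nonout_arcs \subset arcs e by apply/subsetP=> a; rewrite inE => /andP[].
apply/eqP; rewrite eqn_leq; apply/andP; split.
  apply: card_pblock_image => //; apply: pblock_inj_arcs => // a b c d.
  rewrite !inE /= => /andP[eab /negP nab] /andP[ecd /negP ncd] _ bcd bda _ _.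
  apply: ncd; case: (bt_last bB r eab) => // rba.
  have [rbd dar] := (bt_suffix bB rba bda).
  by have [] := bt_suffix bB dar bcd.
apply: leq_trans (leq_imset_card (pblock P) nonout_arcs).
apply: subset_leq_card; apply/subsetP=> C CP.
have [a aC nra] := directed_cycle_exit r bB (cycP CP).
apply/imsetP; exists a; last by rewrite (def_pblock trivP CP aC).
rewrite inE nra andbT inE -coverP; exact/bigcupP/(ex_intro2 _ _ C).
Qed.

Lemma card_nonin_arcs : #|nonin_arcs| <= #|P|.
Proof.
have sub : nonin_arcs \subset arcs e by apply/subsetP=> a; rewrite inE => /andP[].
apply: card_pblock_image => //; apply: pblock_inj_arcs => // a b c d.
rewrite !inE /= => /andP[eab /negP nab] /andP[ecd /negP ncd] _ bcd bda _ _.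
apply: ncd; case: (bt_first bB r eab) => // bar.
have [bdr dar] := bt_prefix bB bar bda.
by have [] := bt_prefix bB bdr bcd.
Qed.

(** Every vertex other than [r] is the head of an arc of the out-tree, and each block adds one arc
    outside it. *)
Lemma card_arcs_ge : #|T| + #|P| <= #|arcs e|.+1.
Proof.
have out_tree : [set~ r] \subset snd @: (arcs e :\: nonout_arcs).
  apply/subsetP=> x; rewrite !inE eq_sym => xr.
  have [y eyx ryx] := bt_pred bB xr.
  by apply/imsetP; exists (y, x); rewrite // !inE /= eyx ryx.
have := leq_trans (subset_leq_card out_tree) (leq_imset_card _ _).
rewrite cardsC1 cardsD -card_nonout_arcs.
have /setIidPr -> : nonout_arcs \subset arcs e.
  by apply/subsetP=> a; rewrite inE => /andP[].
have : #|nonout_arcs| <= #|arcs e|.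
  by apply: subset_leq_card; apply/subsetP=> a; rewrite inE => /andP[].
have : 0 < #|T| by apply/card_gt0P; exists r.
move: #|arcs e| #|nonout_arcs| #|T| => m o n; lia.
Qed.

(** Of at least n + q - 1 arcs, at most q are missing from the out-tree and at most q from the
    in-tree. *)
Lemma card_off_gate_arcs :
  #|T| <= #|[set a | off_gate e B r a.1 a.2]| + #|P| + 1.
Proof.
have sub : arcs e \subset
    [set a | off_gate e B r a.1 a.2] :|: (nonout_arcs :|: nonin_arcs).
  apply/subsetP=> -[a b]; rewrite !inE /= /off_gate => eab.
  by rewrite eab; case: (B r a b); case: (B a b r).
have := leq_trans (subset_leq_card sub) (leq_card_setU _ _).
have [+ _] := leq_card_setU nonout_arcs nonin_arcs.
have := card_arcs_ge; have := card_nonin_arcs; rewrite card_nonout_arcs.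
move: #|[set a | _]| #|_ :|: _| #|nonin_arcs| #|arcs e| #|T| #|P| => o u i m n q; lia.
Qed.

(** For x other than [r], let p precede x on the dipath from [r] and s follow it on the dipath to
    [r]. If p -> x or x -> s touches a gate, then x is the head of one of at most q arcs or the tail
    of one of q arcs. *)
Lemma card_off_gate_vertices :
  #|T| <= #|off_gate_vertices e B r| + 2 * #|P| + 1.
Proof.
have sub : [set~ r] \subset
    off_gate_vertices e B r :|: (fst @: nonout_arcs :|: snd @: nonin_arcs).
  apply/subsetP=> x; rewrite !inE => xr.
  have [s exs xsr] := bt_succ bB xr.
  rewrite eq_sym in xr; have [p epx rpx] := bt_pred bB xr.
  have [pxr|npxr] := boolP (B p x r); last first.
    apply/orP; right; apply/orP; right; apply/imsetP; exists (p, x) => //.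
    by rewrite !inE /= epx.
  have [rxs|nrxs] := boolP (B r x s); last first.
    apply/orP; right; apply/orP; left; apply/imsetP; exists (x, s) => //.
    by rewrite !inE /= exs.
  apply/orP; left; apply/andP; split; apply/existsP; [exists p|exists s].
    by rewrite /off_gate epx pxr.
  by rewrite /off_gate exs xsr.
have := leq_trans (subset_leq_card sub) (leq_card_setU _ _); rewrite cardsC1.
have [+ _] := leq_card_setU (fst @: nonout_arcs) (snd @: nonin_arcs).
have := leq_imset_card fst nonout_arcs; have := leq_imset_card snd nonin_arcs.
have := card_nonin_arcs; rewrite card_nonout_arcs.
have : 0 < #|T| by apply/card_gt0P; exists r.
move: #|off_gate_vertices e B r| #|_ :|: _| #|fst @: _| #|snd @: _| #|nonin_arcs|.
move: #|T| #|P| => n q v u o i i'; lia.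
Qed.

End Counting.

(** * Lower bounds from the clique *)

Section Lower.
Variables (T : finType) (e : rel T).
Hypothesis cacte : cactus e.
Implicit Types a b c d s t u v w x y z : T.
Local Notation B := (between cacte).
Local Notation bB := (between_betweenness cacte).
Variables (P : {set {set T * T}}).
Hypotheses (partP : partition P (arcs e)) (cycP : forall C, C \in P -> directed_cycle e C).

(** Some vertex [r] is the tail of two arcs: otherwise there are at most n arcs, against n + q - 1 >
    n. *)
Lemma exists_pivot : 2 <= #|P| -> exists k r l, [/\ e k r, e r l & ~ B r l k].
Proof.
move=> P2.
have [C CP] : exists C, C \in P by apply/set0Pn; rewrite -card_gt0; lia.
have [a0 _ _] : exists2 a : T * T, a \in C & true.
  by case/and3P: partP => _ _; case: (set_0Vmem C) CP => [-> -> //|[a aC] _ _]; exists a.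
have [/exists_inP[[r l] rlA /exists_inP[[r' l'] rlA' /andP[/eqP /= rE nE]]]|noex] :=
    boolP [exists a in arcs e, exists b in arcs e, (a.1 == b.1) && (a != b)].
  subst r'; rewrite !inE /= in rlA rlA'.
  have lr : l' != r by apply/eqP=> lr; rewrite lr in rlA'; case: (bt_irrefl bB rlA').
  (* The vertex [k] closes the block of the other arc r -> l', so the dipath from [r] to [k] starts
     with [l'] and not with [l]. *)
  have [k ekr l'kr] := bt_pred bB lr; exists k, r, l; split=> // rlk.
  case: (bt_first bB k rlA') => [rl'k|l'rk]; last first.
    have rk := bt_anti bB l'rk l'kr; by rewrite rk in ekr; case: (bt_irrefl bB ekr).
  have irr x : ~ e x x := @bt_irrefl _ _ _ bB x.
  have ll' : l = l'.
    case: (bt_total bB rlk rl'k) => h.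
      by case: (bt_arc bB rlA' h) => // lE; case: (irr r); rewrite -{2}lE.
    by case: (bt_arc bB rlA h) => // lE; case: (irr r); rewrite -{2}lE.
  by rewrite ll' eqxx in nE.
have inj : {in arcs e &, injective (@fst T T)}.
  move=> a b aA bA /= abE; apply/eqP/negPn/negP=> nE; case/negP: noex.
  by apply/exists_inP; exists a => //; apply/exists_inP; exists b; rewrite // abE eqxx.
have := card_arcs_ge cacte partP cycP a0.1; rewrite -(card_in_imset inj).
have := max_card [in fst @: arcs e]; move: P2.
move: #|fst @: _| #|T| #|P| => m n q; lia.
Qed.

Lemma clique_card_le (X : finType) (K : finType) (c : X -> K) (U : {set X}) :
  {in U &, forall i j, i != j -> c i != c j} -> #|U| <= #|K|.
Proof.
move=> neq; rewrite -(card_in_imset (f := c) (D := U)) ?max_card //.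
by move=> i j iU jU; apply: contra_eq; apply: neq.
Qed.

(** The items whose colours [total_rainbow_path] compares, gathered in one list. *)
Definition path_items s p : seq (T + T * T) :=
  [seq inl v | v <- internal s p] ++ [seq inr i | i <- path_arcs s p].

Lemma inl_path_items s p x : (inl x \in path_items s p) = (x \in internal s p).
Proof.
rewrite mem_cat mem_map; last by move=> ? ? [].
by rewrite orbC; case: mapP => // -[].
Qed.

Lemma inr_path_items s p (a : T * T) : (inr a \in path_items s p) = (a \in path_arcs s p).
Proof.
rewrite mem_cat [X in _ || X]mem_map; last by move=> ? ? [].
by case: mapP => // -[].
Qed.

Lemma traversed_path s t p (i : T + T * T) :
  dipath e s t p -> traversed e B s t i -> i \in path_items s p.
Proof.
move=> dp; case: i => [x|[a b]]; rewrite ?inl_path_items ?inr_path_items /=.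
  rewrite (betweenE _ _ dp) => /and3P[xp xs xt].
  case: p dp xp => [|y p] dp; first by rewrite inE (negPf xs).
  rewrite lastI mem_rcons inE; case/and3P: dp => _ /eqP lt _.
  by rewrite lt (negPf xt) /internal /= inE (negPf xs).
case/and3P=> eab sat abt.
have [p1 [p2 [d1 d2 d]]] := betweenP sat.
rewrite (dipath_unique cacte dp d).
have l1 : last s p1 = a by case/and3P: d1 => _ /eqP.
(* The part of [p2] up to [b] is the dipath from [a] to [b], which is a single arc. *)
have p2E : exists q, p2 = b :: q.
  move: abt; rewrite (betweenE _ _ d2) inE => /predU1P[ab|].
    by rewrite ab in eab; case: (bt_irrefl bB eab).
  move=> bp2; case/splitPr: bp2 d2 => q1 q2; rewrite -cat_rcons => d2.
  have [d3 _] := dipath_catP d2; rewrite last_rcons in d3.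
  have := dipath_unique cacte d3 (dipath_arc cacte eab).
  by move=> ->; exists q2.
have [q ->] := p2E; rewrite /path_arcs -cat_cons lastI l1 cat_rcons zip_cat ?size_belast //.
by rewrite mem_cat mem_head orbT.
Qed.

Lemma joined_dipath good x y p :
  joined e good x y -> dipath e x y p -> good x p.
Proof.
case/existsP=> m /existsP[p' /andP[d' g]] d.
by rewrite (dipath_unique cacte d d').
Qed.

Variables k r l : T.
Hypotheses (ekr : e k r) (erl : e r l) (nrlk : ~ B r l k).
Let S := off_gate_vertices e B r :|: [set k; r; l].
Let A : {set T * T} := [set a | off_gate e B r a.1 a.2] :|: [set (k, r); (r, l)].
Let irr x : ~ e x x := @bt_irrefl _ _ _ bB x.

Definition clique : {set T + T * T} := (inl @: S) :|: (inr @: A).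

Lemma clique_sub : clique \subset off_gate_items e B r :|: pivot_items k r l.
Proof.
apply/subsetP=> i /setUP[]/imsetP[x xS ->].
  case/setUP: xS => [xS|xS]; apply/setUP; [left|right]; first by rewrite inE.
  by move: xS; rewrite !inE -!orbA => /or3P[] /eqP ->; rewrite eqxx ?orbT.
case/setUP: xS => [xS|xS]; apply/setUP; [left|right]; first by move: xS; rewrite !inE.
by move: xS; rewrite !inE => /orP[] /eqP ->; rewrite eqxx ?orbT.
Qed.

Lemma clique_dipath (i j : T + T * T) : i \in clique -> j \in clique -> i != j ->
  exists s t p, [/\ dipath e s t p, i \in path_items s p & j \in path_items s p].
Proof.
move=> /(subsetP clique_sub) iU /(subsetP clique_sub) jU nij.
have [s [t [ti tj]]] := clique_compatible bB ekr erl nrlk iU jU nij.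
have [p dp] := dipath_exists cacte s t; exists s, t, p.
by rewrite !(traversed_path dp).
Qed.

(** The pivot adds three new vertices: [r] is the head of no off-gate arc, [k] the tail of none and
    [l] the head of none. This gives (n - 2q - 1) + 3. *)
Lemma card_vertex_clique : #|T| + 2 <= #|S| + 2 * #|P|.
Proof.
have nkl : k != l by apply/eqP=> kl; case: (bt_asym bB ekr); rewrite kl.
have nkr : k != r by apply/eqP=> kr; case: (@irr r); rewrite -{1}kr.
have nrl : r != l by apply/eqP=> rl; case: (@irr r); rewrite {2}rl.
have c3 : #|[set k; r; l]| = 3.
  by rewrite -setUA cardsU1 cards2 !inE negb_or nkr nkl nrl.
have dis : off_gate_vertices e B r :&: [set k; r; l] = set0.
  apply/setP=> x; rewrite in_set0; apply/negP=> /setIP[/off_gate_verticesP[p [s [o1 o2]]]].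
  have xr := off_gate_head bB o1.
  case/off_gateP: o1 => epx pxr rpx; case/off_gateP: o2 => exs xsr rxs.
  rewrite !inE -orbA => /or3P[] /eqP xE; subst x => //.
    case: (bt_arc bB ekr xsr) => sE; subst s; first exact: (irr exs).
    by have rk := bt_loop bB rxs; rewrite rk eqxx in nkr.
  case: (bt_arc bB erl rpx) => pE; subst p; last exact: (irr epx).
  by have lr := bt_loop bB pxr; rewrite lr eqxx in nrl.
have := card_off_gate_vertices cacte partP cycP r.
rewrite /S cardsU dis cards0 subn0 c3.
move: #|off_gate_vertices e B r| #|T| #|P| => v n q; lia.
Qed.

(** Both pivot arcs touch [r] and are not off-gate, giving (n - q - 1) + 2. *)
Lemma card_arc_clique : #|T| + 1 <= #|A| + #|P|.
Proof.
have nkr : k != r by apply/eqP=> kr; case: (@irr r); rewrite -{1}kr.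
have nrl : r != l by apply/eqP=> rl; case: (@irr r); rewrite {2}rl.
have c2 : #|[set (k, r); (r, l)]| = 2 by rewrite cards2 xpair_eqE (negPf nkr).
have dis : [set a | off_gate e B r a.1 a.2] :&: [set (k, r); (r, l)] = set0.
  apply/setP=> a; rewrite in_set0; apply/negP; rewrite !inE => /andP[/and3P[_ h1 h2]].
  case/orP=> /eqP aE; subst a; rewrite /= in h1 h2.
    by have kr := bt_loop bB h2; rewrite kr eqxx in nkr.
  by have lr := bt_loop bB h1; rewrite lr eqxx in nrl.
have := card_off_gate_arcs cacte partP cycP r.
rewrite /A cardsU dis cards0 subn0 c2.
move: #|[set a | _]| #|T| #|P| => v n q; lia.
Qed.

(** The dipath traversing two vertices of the clique is the only one between its ends, so it is
    rainbow and their colours differ. *)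
Lemma rvc_lower m : rvc_colourable e m -> #|T| + 2 <= m + 2 * #|P|.
Proof.
case/existsP=> c /forallP joinedc.
have : #|S| <= #|'I_m|.
  apply: (clique_card_le (c := c)) => x y xS yS nxy.
  have xU : inl x \in clique by rewrite in_setU imset_f.
  have yU : inl y \in clique by rewrite in_setU imset_f.
  have [|s [t [p [dp]]]] := clique_dipath xU yU.
    by apply: contraNneq nxy => -[->].
  rewrite !inl_path_items => xp yp.
  have := joined_dipath (forallP (joinedc s) t) dp.
  rewrite /rainbow_vertex_path => /uniq_map_inj/(_ x y xp yp) inj.
  by apply: contraNneq nxy => /inj ->.
have := card_vertex_clique; rewrite card_ord.
move: #|S| #|T| #|P| => v n q; lia.
Qed.

Lemma total_rainbow_pathE (K : eqType) (c : T + T * T -> K) s p :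
  total_rainbow_path c s p = uniq [seq c i | i <- path_items s p].
Proof. by rewrite map_cat -!map_comp. Qed.

Lemma card_clique : #|clique| = #|S| + #|A|.
Proof.
rewrite /clique cardsU; have -> : (inl @: S) :&: (inr @: A) = set0 :> {set T + T * T}.
  by apply/setP=> i; rewrite in_set0; apply/negP=> /setIP[/imsetP[x _ ->] /imsetP[]].
by rewrite cards0 subn0 !card_imset //; move=> ? ? [].
Qed.

Lemma trc_lower m : trc_colourable e m -> 2 * #|T| + 3 <= m + 3 * #|P|.
Proof.
case/existsP=> c /forallP joinedc.
have : #|clique| <= #|'I_m|.
  apply: (clique_card_le (c := c)) => i j iU jU nij.
  have [s [t [p [dp ip jp]]]] := clique_dipath iU jU nij.
  have := joined_dipath (forallP (joinedc s) t) dp.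
  rewrite total_rainbow_pathE => /uniq_map_inj/(_ i j ip jp) inj.
  by apply: contraNneq nij => /inj ->.
have := card_vertex_clique; have := card_arc_clique; rewrite card_clique card_ord.
move: #|S| #|A| #|T| #|P| => v a n q; lia.
Qed.

End Lower.

(** * Leaf blocks *)

(* A directed cycle w -> u -> ... -> v -> w attached to the rest of the cactus,
   which contains r, at w only. *)
Record leaf_block (T : finType) (e : rel T) (B : T -> T -> T -> bool) (r w u v : T) : Prop :=
  LeafBlock {
    lb_first : e w u;
    lb_last : e v w;
    lb_wuv : B w u v;
    lb_uvw : B u v w;
    lb_rwu : B r w u;
    lb_rwv : B r w v;
    lb_uwr : B u w r;
    lb_vwr : B v w r;
    lb_gate : ~ B w u r;
    lb_pred : forall x, e x u -> x = w;
    lb_succ : forall y, e v y -> y = w;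
    lb_deep : forall c d, e c d -> B r w c -> c <> w -> B c d r
  }.

Section Leaves.
Variables (T : finType) (e : rel T) (B : T -> T -> T -> bool).
Hypothesis bB : betweenness e B.
Implicit Types a b c d r s t u v w x y z : T.
Local Notation irr := (bt_irrefl bB).

Lemma arc_neq a b : e a b -> a <> b.
Proof. by move=> eab ab; move: eab; rewrite ab => /irr. Qed.

(* Take an arc w -> u pointing away from the gate w of its block towards r, with
   w as far from r as possible. *)
Lemma leaf_block_exists r c d : e c d -> ~ B c d r ->
  exists w u v, (c <> r -> w <> r) /\ leaf_block e B r w u v.
Proof.
move=> ecd ncd.
pose depth x := #|[set z | B r z x]|.
pose nonin (a : T * T) := e a.1 a.2 && ~~ B a.1 a.2 r.
have nin_cd : nonin (c, d) by rewrite /nonin ecd; apply/negP.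
case: (@arg_maxnP _ (c, d) nonin (fun a : T * T => depth a.1) nin_cd) => -[w u].
rewrite /nonin /= => /andP[ewu /negP nwur] maxw.
have deeper x y : B r x y -> x <> y -> depth x < depth y.
  move=> rxy nxy; apply: proper_card; apply/properP; split.
    by apply/subsetP=> z; rewrite !inE => rzx; have [] := bt_prefix bB rxy rzx.
  exists y; rewrite !inE ?(bt_target bB) //; apply/negP=> ryx.
  exact: nxy (bt_anti bB rxy ryx).
have wr : c <> r -> w <> r.
  move=> ncr wr; have := maxw _ nin_cd; rewrite /geq /= leqNgt => /negP; apply.
  by rewrite wr; apply: deeper; [apply: (bt_source bB) | move=> rc; apply: ncr].
have deep x y : e x y -> B r w x -> x <> w -> B x y r.
  move=> exy rwx nxw; apply/negPn/negP=> nxy.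
  have nin_xy : nonin (x, y) by rewrite /nonin exy.
  have := maxw _ nin_xy; rewrite /geq /= leqNgt => /negP; apply.
  by apply: deeper => // wx; apply: nxw.
have nuw := arc_neq ewu.
have uwr : B u w r by case: (bt_first bB r ewu).
have rwu : B r w u.
  by case: (bt_last bB r ewu) => // ruw; case: (arc_not_hung bB ewu ruw uwr).
have /eqP uw : u <> w by move=> uw; apply: nuw.
have [v evw uvw] := bt_pred bB uw.
have nvw := arc_neq evw.
have wuv : B w u v.
  by case: (bt_first bB v ewu) => // uwv; case: nvw; exact: (bt_anti bB uvw uwv).
have [_ vwr] := bt_prefix bB uwr uvw.
have ruv : B r u v by case: (bt_triangle bB r wuv).
have [rwv _] := bt_prefix bB ruv rwu.
(* Beyond [w] every arc begins the dipath to [r], so all vertices there have a single successor. *)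
have succ x y z : B r w x -> x <> w -> e x y -> e x z -> y = z.
  move=> rwx nxw exy exz.
  exact: (same_succ bB exy exz (deep _ _ exy rwx nxw) (deep _ _ exz rwx nxw)).
have [u' euu' uu'w] := bt_succ bB uw.
have nuu' := arc_neq euu'.
have return_through x : e x u -> B u u' x -> B u' x u.
  move=> exu uu'x; case: (bt_last bB u' exu) => // u'ux.
  by case: nuu'; exact: (bt_antir bB uu'x u'ux).
exists w, u, v; split=> //; split=> //.
(* The dipaths from [u] to [w] and to [x] both begin with u -> u', so [w] and [x] both lie on the
   dipath from [u'] to [u], and both have an arc to its end. *)
- move=> x exu; have /eqP ux : u <> x by move=> ux; exact: (arc_neq exu (esym ux)).
  have [y euy uyx] := bt_succ bB ux.
  have yu' : y = u' by apply: (succ u) => //; apply/eqP.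
  subst y; have h1 := return_through _ ewu uu'w; have h2 := return_through _ exu uyx.
  case: (bt_total bB h1 h2) => h.
    have [_ h'] := bt_prefix bB h2 h; case: (bt_arc bB ewu h') => // xu.
    by rewrite xu eqxx in ux.
  have [_ h'] := bt_prefix bB h1 h.
  by case: (bt_arc bB exu h') => // wu; case: nuw.
- by move=> y evy; apply: (succ v) => // vw; apply: nvw.
Qed.

(** * Two leaf blocks, the second found from a vertex of the first *)

Section TwoLeaves.
Variables r w1 u1 v1 w2 u2 v2 : T.
Hypotheses (leaf1 : leaf_block e B r w1 u1 v1) (leaf2 : leaf_block e B u1 w2 u2 v2).
Hypothesis w2u1 : w2 <> u1.

Lemma leaves_first_neq : u1 <> u2.
Proof. by move=> uE; apply: (lb_gate leaf2); rewrite -uE; apply: (bt_target bB). Qed.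

Lemma leaves_enter : B u1 w2 u2.
Proof. exact: lb_rwu leaf2. Qed.

(** Otherwise [w2] would precede [u2] on the way to [w1], while the return from [u2] to [u1] passes
    [w2]. This puts [w2] on w1 -> u1, hence [w2 = w1], which the dipath from [u1] reaches both
    before and after [u2]. *)
Lemma leaf2_notin_leaf1 : ~ B u1 u2 w1.
Proof.
move=> u1u2w1; have nuw := arc_neq (lb_first leaf2).
have [_ w2u2w1] := bt_prefix bB u1u2w1 leaves_enter.
case: (bt_triangle bB w1 (lb_uwr leaf2)) => h.
  by apply: nuw; exact: (bt_antir bB w2u2w1 h).
case: (bt_arc bB (lb_first leaf1) h) => // wE; apply: nuw.
by have := leaves_enter; rewrite wE => h2; exact: (bt_anti bB h2 u1u2w1).
Qed.

Lemma leaf2_deep : B r w1 w2 -> w2 <> w1 -> B u1 w1 u2.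
Proof.
move=> rw1w2 nw; have := lb_deep leaf1 (lb_first leaf2) rw1w2 nw.
case/(bt_triangle bB u1) => [/(lb_gate leaf2)//|u1u2r].
by case: (bt_total bB (lb_uwr leaf1) u1u2r) => // /leaf2_notin_leaf1.
Qed.

(** Such a dipath would make [u1] lie between [r] and [u2], hence [w2] lie strictly beyond [w1].
    Then [leaf2_deep] puts [w1] between [u1] and [u2], against the order w1, u1, u2. *)
Lemma not_through_first12 : ~ B w1 u1 u2.
Proof.
move=> h; have nwu := arc_neq (lb_first leaf1).
have ru1u2 : B r u1 u2 by case: (bt_triangle bB r h) => // /(lb_gate leaf1).
have [_ ru1w2] := bt_suffix bB ru1u2 leaves_enter.
have [rw1w2 _] := bt_prefix bB ru1w2 (lb_rwu leaf1).
have nw : w2 <> w1.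
  move=> wE; rewrite wE in ru1w2.
  by apply: nwu; exact: (bt_anti bB (lb_rwu leaf1) ru1w2).
by apply: nwu; exact: (bt_antir bB h (leaf2_deep rw1w2 nw)).
Qed.

Lemma not_through_first21 : ~ B w2 u2 u1.
Proof. exact: lb_gate leaf2. Qed.

Lemma leaves_last_neq : v1 <> v2.
Proof.
move=> vE; have := lb_last leaf2; rewrite -vE => /(lb_succ leaf1) wE.
have := lb_rwv leaf2; rewrite -vE wE => h.
exact: (arc_neq (lb_first leaf1)) (bt_antir bB (lb_wuv leaf1) h).
Qed.

Lemma last2_neq_first1 : v2 <> u1.
Proof. by move=> vE; have := lb_rwv leaf2; rewrite vE => /(bt_loop bB). Qed.

Lemma last1_neq_first2 : v1 <> u2.
Proof. by move=> vE; apply: leaf2_notin_leaf1; rewrite -vE; apply: (lb_uvw leaf1). Qed.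

(** Compare with [u1]: the dipath from [v1] to [u1] is v1 -> w1 -> u1, without [v2], and the one
    from [u1] reaches [w2] before [v2]. *)
Lemma not_through_last12 : ~ B v1 v2 w2.
Proof.
have succ2 : v2 <> w1.
  move=> vE; have := lb_first leaf1; rewrite -vE => /(lb_succ leaf2) uE.
  exact: w2u1.
move=> /(bt_triangle bB u1)[] h; last first.
  by apply: (arc_neq (lb_last leaf2)); exact: (bt_anti bB h (lb_rwv leaf2)).
have vwu := two_arcs_between bB (lb_last leaf1) (lb_first leaf1).
case: (bt_total bB h vwu) => h'.
  by case: (bt_arc bB (lb_last leaf1) h') => // /esym/leaves_last_neq.
have [_ h2] := bt_prefix bB h h'.
by case: (bt_arc bB (lb_first leaf1) h2) => // /last2_neq_first1.
Qed.

(** Such a dipath would put [w2] beyond [w1], and then [w2] on the dipath from [w1] to [r] as well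
    as [w1] on the one from [w2] to [r]. *)
Lemma not_through_last21 : ~ B v2 v1 w1.
Proof.
have nvw := arc_neq (lb_last leaf1).
move=> /(bt_triangle bB w2) h.
have {h} w2v1w1 : B w2 v1 w1.
  case: h => // h; case: (bt_arc bB (lb_last leaf2) h) => [/leaves_last_neq //|->].
  exact: (bt_source bB).
have nw : w2 <> w1 by move=> wE; rewrite wE in w2v1w1; apply: nvw; exact: (bt_loop bB w2v1w1).
have rw1w2 : B r w1 w2.
  case: (bt_triangle bB w2 (lb_rwv leaf1)) => // h.
  by case: nvw; exact: (bt_anti bB w2v1w1 h).
have u1w1u2 := leaf2_deep rw1w2 nw.
have := lb_deep leaf1 (lb_first leaf2) rw1w2 nw.
case/(bt_triangle bB u1) => [/(lb_gate leaf2)//|u1u2r].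
case: (bt_total bB u1w1u2 leaves_enter) => h; last first.
  have [_ h'] := bt_prefix bB u1w1u2 h.
  case: (bt_arc bB (lb_first leaf2) h') => [wE|wE]; first exact: nw.
  by apply: leaf2_notin_leaf1; rewrite -wE; apply: (bt_target bB).
have [u1w2r _] := bt_prefix bB u1u2r leaves_enter.
have [_ w1w2r] := bt_prefix bB u1w2r h.
case: (bt_triangle bB r w2v1w1) => h'; last first.
  by apply: nvw; exact: (bt_anti bB h' (lb_rwv leaf1)).
have [w2w1r _] := bt_suffix bB h' (lb_vwr leaf1).
exact: nw (bt_antir bB w2w1r w1w2r).
Qed.

(** The only arcs into [u1] and [u2] come from [w1] and [w2], so the dipath would contain w1, u1, u2
    or w2, u2, u1 in this order. *)
Lemma firsts_not_joined s t : B s u1 t -> B s u2 t -> s <> u1 -> s <> u2 -> False.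
Proof.
move=> su1 su2 /eqP ns1 /eqP ns2.
have [y1 /(lb_pred leaf1) -> sw1] := bt_pred bB ns1.
have [y2 /(lb_pred leaf2) -> sw2] := bt_pred bB ns2.
case: (bt_total bB su1 su2) => h.
  by have [_ /not_through_first12] := bt_prefix bB h sw1.
by have [_ /not_through_first21] := bt_prefix bB h sw2.
Qed.

Lemma lasts_not_joined s t : B s v1 t -> B s v2 t -> v1 <> t -> v2 <> t -> False.
Proof.
move=> sv1 sv2 /eqP ns1 /eqP ns2.
have [y1 /(lb_succ leaf1) -> sw1] := bt_succ bB ns1.
have [y2 /(lb_succ leaf2) -> sw2] := bt_succ bB ns2.
case: (bt_total bB sv1 sv2) => h.
  have [_ h'] := bt_prefix bB sv2 h.
  by have [_ /not_through_last12] := bt_suffix bB h' sw2.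
have [_ h'] := bt_prefix bB sv1 h.
by have [_ /not_through_last21] := bt_suffix bB h' sw1.
Qed.

End TwoLeaves.
End Leaves.

(** * Colourings *)

(** Dual to [directed_cycle_exit], with a vertex of the cycle nearest to [r] along dipaths towards
    [r]. *)
Lemma directed_cycle_entry (T : finType) (e : rel T) (B : T -> T -> T -> bool) r C :
  betweenness e B -> directed_cycle e C -> exists2 a, a \in C & ~~ B a.1 a.2 r.
Proof.
move=> bB [c [nc /andP[ec Uc] ->]].
case: c nc ec Uc => // x0 c _ ec Uc; set cy := x0 :: c.
have x0c : x0 \in cy by rewrite mem_head.
case: (@arg_minnP _ x0 [in cy] (fun x => #|[set z | B x z r]|) x0c) => x xc minx.
exists (x, next cy x); first by rewrite -cycle_arcs_mem.
apply/negP; rewrite -[(_, _).1]/x -[(_, _).2]/(next cy x) => xnr.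
have nc : next cy x \in cy by rewrite mem_next.
have exn : e x (next cy x) := next_cycle ec xc.
have := minx _ nc; rewrite leqNgt => /negP; apply; apply: proper_card.
apply/properP; split.
  by apply/subsetP=> z; rewrite !inE => nzr; have [] := bt_suffix bB xnr nzr.
exists x; rewrite !inE ?(bt_source bB) //.
apply/negP=> nxr; have xn := bt_antir bB xnr nxr.
by move: exn; rewrite -xn => /(bt_irrefl bB).
Qed.

Lemma two_leaf_blocks (T : finType) (e : rel T) (cacte : cactus e)
    (P : {set {set T * T}}) :
  partition P (arcs e) -> (forall C, C \in P -> directed_cycle e C) -> 2 <= #|P| ->
  let B := between cacte in
  exists r w1 u1 v1 w2 u2 v2, [/\ leaf_block e B r w1 u1 v1,
    leaf_block e B u1 w2 u2 v2 & w2 <> u1].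
Proof.
move=> partP cycP P2 B; have bB := between_betweenness cacte.
have coverP (a : T * T) : (a \in cover P) = e a.1 a.2.
  by case/and3P: partP => /eqP -> _ _; rewrite inE.
have trivP : trivIset P by case/and3P: partP.
have [C1 [C2 [C1P C2P nC]]] : exists C1 C2, [/\ C1 \in P, C2 \in P & C1 != C2].
  have /card_gt1P[C1 [C2 [? ? ?]]] : 1 < #|P| by [].
  by exists C1, C2.
have entry r C : C \in P -> exists c d, [/\ (c, d) \in C, e c d & ~ B c d r].
  move=> CP; have [[c d] aC /negP nin] := directed_cycle_entry r bB (cycP _ CP).
  exists c, d; split=> //; rewrite -[e c d](coverP (c, d)).
  by apply/bigcupP; exists C.
(* Each of two blocks has an arc missing from the in-tree of [r]. These arcs differ, so they cannot
   both start at a vertex with a single successor. Applied to [u1], this gives [w2 <> u1]. *)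
have other r : (forall y z, e r y -> e r z -> y = z) ->
    exists c d, [/\ e c d, ~ B c d r & c <> r].
  move=> uniqr; have [c1 [d1 [a1 e1 n1]]] := entry r _ C1P.
  have [c2 [d2 [a2 e2 n2]]] := entry r _ C2P.
  have [c1r|/eqP nc1] := eqVneq c1 r; last by exists c1, d1.
  have [c2r|/eqP nc2] := eqVneq c2 r; last by exists c2, d2.
  subst c1 c2; have dd := uniqr _ _ e1 e2; subst d2.
  case/eqP: nC; rewrite -(def_pblock trivP C1P a1).
  by rewrite -(def_pblock trivP C2P a2).
have [[c0 d0] _ _] : exists2 a : T * T, a \in C1 & true.
  have [c [nc _ ->]] := cycP _ C1P.
  by case: c nc => // x c _; exists (x, next (x :: c) x); rewrite // -cycle_arcs_mem mem_head.
have [c [d [_ ecd ncd]]] := entry c0 _ C1P.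
have [w1 [u1 [v1 [_ leaf1]]]] := leaf_block_exists bB ecd ncd.
have uniq1 y z : e u1 y -> e u1 z -> y = z.
  have rwu := lb_rwu leaf1; have nuw : u1 <> w1.
    by move=> uw; exact: (arc_neq bB (lb_first leaf1) (esym uw)).
  move=> ey ez; apply: (same_succ bB ey ez); exact: (lb_deep leaf1).
have [c' [d' [ecd' ncd' cu]]] := other u1 uniq1.
have [w2 [u2 [v2 [wu leaf2]]]] := leaf_block_exists bB ecd' ncd'.
by exists c0, w1, u1, v1, w2, u2, v2; split=> //; apply: wu.
Qed.

Section Colouring.
Variables (T : finType) (e : rel T).
Hypothesis cacte : cactus e.

Lemma joined_good (good : T -> seq T -> bool) x y :
  (forall p, dipath e x y p -> good x p) -> joined e good x y.
Proof.
move=> goodp; have [p dp] := dipath_exists cacte x y.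
have [_ _ Up] := and3P dp.
have ltp : size p < #|T| by have := max_card (mem (x :: p)); rewrite (card_uniqP Up).
apply/existsP; exists (Ordinal ltp); apply/existsP; exists (in_tuple p).
by rewrite dp goodp.
Qed.

Lemma rank_colouring (X Y : finType) (f : X -> Y) (A : {set Y}) (x0 : X) :
  (forall x, f x \in A) ->
  exists c : {ffun X -> 'I_#|A|}, forall x y, c x = c y -> f x = f y.
Proof.
(* The point [x0] shows that [A] is inhabited, as [enum_rank_in] requires. *)
move=> fA; exists [ffun x => enum_rank_in (fA x0) (f x)] => x y.
by rewrite !ffunE; apply: enum_rank_in_inj.
Qed.

Lemma rvc_colourable_image (f : T -> T) (A : {set T}) (x0 : T) :
    (forall x, f x \in A) ->
    (forall x y p, dipath e x y p -> uniq (map f (internal x p))) ->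
  rvc_colourable e #|A|.
Proof.
move=> fA Uf; have [c cE] := rank_colouring x0 fA.
apply/existsP; exists c; apply/forallP=> x; apply/forallP=> y.
apply: joined_good => p dp; have := Uf _ _ _ dp; rewrite /rainbow_vertex_path => U.
rewrite map_inj_in_uniq ?(map_uniq U) // => u v uI vI /cE.
exact: (uniq_map_inj U).
Qed.

Lemma trc_colourable_image (f : T + T * T -> T + T) (A : {set T + T}) (x0 : T) :
    (forall x, f x \in A) ->
    (forall x y p, dipath e x y p -> uniq (map f (path_items x p))) ->
  trc_colourable e #|A|.
Proof.
move=> fA Uf; have [c cE] := rank_colouring (inl x0) fA.
apply/existsP; exists c; apply/forallP=> x; apply/forallP=> y.
apply: joined_good => p dp; have := Uf _ _ _ dp; rewrite total_rainbow_pathE => U.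
rewrite map_inj_in_uniq ?(map_uniq U) // => u v uI vI /cE.
exact: (uniq_map_inj U).
Qed.

Local Notation B := (between cacte).
Local Notation bB := (between_betweenness cacte).
Variables r w1 u1 v1 w2 u2 v2 : T.
Hypotheses (leaf1 : leaf_block e B r w1 u1 v1) (leaf2 : leaf_block e B u1 w2 u2 v2).
Hypothesis w2u1 : w2 <> u1.

(** Two maps are needed: [firsts_not_joined] allows [u1] or [u2] to end the dipath, so these can be
    merged as heads of arcs too, whereas [lasts_not_joined] concerns vertices before the end, so
    [v1] and [v2] are merged only as vertices. *)
Definition merge_heads x := if x == u2 then u1 else x.
Definition merge_ends x := if x == v2 then v1 else merge_heads x.

Lemma leaf_first_neq_last s w u v : leaf_block e B s w u v -> u <> v.
Proof. by move=> lb uv; case: (bt_asym bB (lb_first lb)); rewrite uv; apply: (lb_last lb). Qed.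

Lemma merge_heads_in x : merge_heads x \in [set~ u2].
Proof.
rewrite !inE /merge_heads; case: (x =P u2) => [_|/eqP //].
exact/eqP/(leaves_first_neq bB leaf2).
Qed.

Lemma merge_ends_in x : merge_ends x \in ~: [set u2; v2].
Proof.
rewrite !inE /merge_ends; case: (x =P v2) => [_|/eqP xv].
  rewrite negb_or; apply/andP; split; apply/eqP.
    exact: (last1_neq_first2 bB leaf1 leaf2 w2u1).
  exact: (leaves_last_neq bB leaf1 leaf2).
have := merge_heads_in x; rewrite !inE negb_or => -> /=; rewrite /merge_heads.
case: (x =P u2) => // _; apply/eqP=> uv; exact: (last2_neq_first1 bB leaf2 w2u1 (esym uv)).
Qed.

Lemma merge_heads_uniq x y p : dipath e x y p -> uniq (map merge_heads p).
Proof.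
move=> dp; have [_ _ /andP[xp Up]] := and3P dp.
have no12 : u1 \in p -> u2 \in p -> False.
  move=> u1p u2p; apply: (firsts_not_joined bB leaf1 leaf2 w2u1 (s := x) (t := y)).
  - by rewrite (betweenE _ _ dp) inE u1p orbT.
  - by rewrite (betweenE _ _ dp) inE u2p orbT.
  - by move=> xu; rewrite xu u1p in xp.
  - by move=> xu; rewrite xu u2p in xp.
rewrite map_inj_in_uniq // => a b ap bp; rewrite /merge_heads.
case: (a =P u2) => [aE|_]; case: (b =P u2) => [bE|_] //; first by rewrite aE bE.
- by move=> E; subst a b; case: no12.
- by move=> E; subst a b; case: no12.
Qed.

Lemma internal_between x y p z : dipath e x y p -> z \in internal x p ->
  [/\ z \in p, B x z y & z <> y].
Proof.
move=> dp; have [_ /eqP lp Up] := and3P dp.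
case: p lp Up dp => [|a p] //=; rewrite /internal /= => lp Up dp zp.
have zin : z \in a :: p by rewrite lastI mem_rcons inE zp orbT.
split=> //; first by rewrite (betweenE _ _ dp) inE zin orbT.
move=> zy; move: Up => /andP[_]; rewrite -[_ && _]/(uniq (a :: p)) lastI rcons_uniq.
by rewrite lp -zy zp.
Qed.

Lemma merge_ends_uniq x y p : dipath e x y p -> uniq (map merge_ends (internal x p)).
Proof.
move=> dp; have [_ _ Uxp] := and3P dp.
have Uh := merge_heads_uniq dp.
rewrite map_inj_in_uniq ?uniq_internal // => a b aI bI.
have [ap xay ay] := internal_between dp aI.
have [bp xby by_] := internal_between dp bI.
have injh := uniq_map_inj Uh ap bp.
(* As [u1 <> v1], merging the heads sends no other vertex to [v1]. *)
have mv c : c <> v2 -> merge_heads c = v1 -> c = v1.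
  move=> _; rewrite /merge_heads; case: (c =P u2) => // _ uv.
  by case: (leaf_first_neq_last leaf1).
rewrite /merge_ends; case: (a =P v2) => [aE|na]; case: (b =P v2) => [bE|nb] //.
- by rewrite aE bE.
- move/esym/(mv _ nb) => bE; subst a b.
  by case: (lasts_not_joined bB leaf1 leaf2 w2u1 xby xay).
- move/(mv _ na) => aE; subst a b.
  by case: (lasts_not_joined bB leaf1 leaf2 w2u1 xay xby).
Qed.

Lemma rvc_upper : rvc_colourable e (#|T| - 2).
Proof.
have nuv : u2 != v2 by apply/eqP; apply: leaf_first_neq_last leaf2.
have <- : #|~: [set u2; v2]| = #|T| - 2 by rewrite cardsCs setCK cards2 nuv.
exact: (rvc_colourable_image u1 merge_ends_in merge_ends_uniq).
Qed.

Definition merge_items (i : T + T * T) : T + T :=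
  match i with inl x => inl (merge_ends x) | inr a => inr (merge_heads a.2) end.

(** Vertices have n - 2 names and arcs n - 1, kept apart by the disjoint sum. *)
Lemma trc_upper : trc_colourable e (#|T| - 2 + (#|T| - 1)).
Proof.
have nuv : u2 != v2 by apply/eqP; apply: leaf_first_neq_last leaf2.
pose A : {set T + T} := (inl @: (~: [set u2; v2])) :|: (inr @: [set~ u2]).
have <- : #|A| = #|T| - 2 + (#|T| - 1).
  rewrite /A cardsU.
  have -> : (inl @: (~: [set u2; v2])) :&: (inr @: [set~ u2]) = set0 :> {set T + T}.
    by apply/setP=> i; rewrite in_set0; apply/negP=> /setIP[/imsetP[x _ ->] /imsetP[]].
  rewrite cards0 subn0 !card_imset; try by move=> ? ? [].
  by rewrite cardsC1 subn1 cardsCs setCK cards2 nuv.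
apply: (trc_colourable_image (f := merge_items) u1).
  case=> [x|a]; apply/setUP; [left|right]; apply: imset_f.
    exact: merge_ends_in.
  exact: merge_heads_in.
move=> x y p dp; rewrite /path_items map_cat -!map_comp.
have -> : [seq (merge_items \o inl) i | i <- internal x p]
    = map inl (map merge_ends (internal x p)) by rewrite -map_comp.
(* The heads of the arcs along the dipath are the entries of [p]. *)
have -> : [seq (merge_items \o inr) i | i <- path_arcs x p] = map inr (map merge_heads p).
  rewrite -[p in RHS](@unzip2_zip _ _ (x :: p) p) /=; last exact: leqnSn.
  by rewrite -!map_comp.
have inl_inj : injective (@inl T T) by move=> ? ? [].
have inr_inj : injective (@inr T T) by move=> ? ? [].
rewrite cat_uniq (map_inj_uniq inl_inj) (map_inj_uniq inr_inj).
rewrite (merge_ends_uniq dp) (merge_heads_uniq dp) andbT /=.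
by apply/hasPn=> _ /mapP[z _ ->]; apply/mapP=> -[].
Qed.

End Colouring.

Import Order.TTheory GRing.Theory Num.Theory.
Local Open Scope ring_scope.

Theorem theorem25 (T : finType) (e : rel T) (n q : nat)
    (hQ : nq_cactus n q e) (hq : (2 <= q)%N) :
  (n%:Z - 2 * q%:Z + 2 <= (rvc e)%:Z /\ (rvc e)%:Z <= n%:Z - 2) /\
  (2 * n%:Z - 3 * q%:Z + 3 <= (trc e)%:Z /\ (trc e)%:Z <= 2 * n%:Z - 3).
Proof.
case: hQ => cacte nE [P [partP cycP qE]]; subst n q.
have [k [r [l [ekr erl nrlk]]]] := exists_pivot cacte partP cycP hq.
have [r' [w1 [u1 [v1 [w2 [u2 [v2 [leaf1 leaf2 w2u1]]]]]]]] := two_leaf_blocks cacte partP cycP hq.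
have [rvc_col rvc_min] := rvcP (cactus_strong cacte).
have [trc_col trc_min] := trcP (cactus_strong cacte).
have rlo := rvc_lower partP cycP ekr erl nrlk rvc_col.
have tlo := trc_lower partP cycP ekr erl nrlk trc_col.
have rhi := rvc_min _ (rvc_upper leaf1 leaf2 w2u1).
have thi := trc_min _ (trc_upper leaf1 leaf2 w2u1).
(* With two vertices the truncated differences in the upper bounds agree with the integer ones. *)
have nT : (2 <= #|T|)%N.
  apply/card_gt1P; exists k, r; split=> //.
  by apply/eqP; apply: arc_neq ekr; apply: between_betweenness.
move: rlo tlo rhi thi nT; move: (rvc e) (trc e) #|T| #|P| => a b n q; lia.
Qed.
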